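(* Let $u\in C^{2}(\mathbb{R}^{2})$ satisfy, at every point of $\mathbb{R}^2$, $$(u_{y}+x)^{2}u_{xx}-2(u_{y}+x)(u_{x}-y)u_{xy}+(u_{x}-y)^{2}u_{yy}=0 .$$ Then $u$ is of one of the following two forms: (1) $u(x,y)=ax+by+c$ for real constants $a,b,c$; or (2) $u(x,y)=-abx^{2}+(a^{2}-b^{2})xy+aby^{2}+g(-bx+ay)$ for real constants $a,b$ with $a^{2}+b^{2}=1$ and some function $g\in C^{2}(\mathbb{R})$.
   Context: The displayed equation is the p-minimal graph equation for the graph $\{(x,y,u(x,y))\}$ in the 3-dimensional Heisenberg group $H_1$ (identified with $\mathbb{R}^3$, with contact form $dz+x\,dy-y\,dx$). *)

(* Defs.v *)
From Stdlib Require Import Reals.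
From Coquelicot Require Import Coquelicot.
Open Scope R_scope.

Definition dx (u : R -> R -> R) : R -> R -> R :=
  fun x y => Derive (fun t => u t y) x.
Definition dy (u : R -> R -> R) : R -> R -> R :=
  fun x y => Derive (fun t => u x t) y.

Definition cont2 (f : R -> R -> R) : Prop :=
  forall x y, continuous (fun p : R * R => f (fst p) (snd p)) (x, y).

Definition has_partials (f : R -> R -> R) : Prop :=
  forall x y, ex_derive (fun t => f t y) x /\ ex_derive (fun t => f x t) y.

Definition C2_plane (u : R -> R -> R) : Prop :=
  has_partials u /\ has_partials (dx u) /\ has_partials (dy u) /\
  cont2 u /\ cont2 (dx u) /\ cont2 (dy u) /\
  cont2 (dx (dx u)) /\ cont2 (dy (dx u)) /\
  cont2 (dx (dy u)) /\ cont2 (dy (dy u)).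

Definition C2_line (g : R -> R) : Prop :=
  forall t, ex_derive g t /\ ex_derive (Derive g) t /\
            continuity_pt g t /\ continuity_pt (Derive g) t /\
            continuity_pt (Derive (Derive g)) t.

(* Main.v *)
(** Write F = (P, Q) = (u_x - y, u_y + x), so that Q_x - P_y = 2, and let T be the unit vector
(Q, - P) / |F| where F <> 0. The equation says that T is constant along its own integral curves,
which are therefore straight lines. In coordinates where such a line is the x-axis one has P = 0,
and m = P_y / Q satisfies m' = m^2; as Q' = m Q + 2, this gives
Q (1 - m_0 x) = d + 2 x - m_0 x^2. Since Q stays finite, Q' >= 1 on the axis, so each characteristic
line, followed backwards, reaches within distance |F| a zero S of F, where dF(S) T = mu N with mu = 1
or 2 and N normal to T. If dF(S) is invertible at some zero S, then S is isolated, all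
characteristic lines are rays issuing from S, F is the rotation by a right angle about S and u is
affine. Otherwise mu = 2 at all zeros, and each ray is continued beyond its end point by the
opposite ray, which is a limit of nearby rays. Two non-parallel full lines would meet at a common
zero S, where dF(S) would be twice the rotation by a right angle, contradicting Q_x - P_y = 2; so
all characteristic lines are parallel. *)
Require Import Defs.
From Stdlib Require Import Reals Lra Psatz Classical.
From Coquelicot Require Import Coquelicot.
Open Scope R_scope.

(* Models (P, Q) = (u_x - y, u_y + x); then [curl_eq] is the symmetry of the Hessian of u. *)
Record pminimal := PMinimal {
  P : R -> R -> R; Q : R -> R -> R;
  Px : R -> R -> R; Py : R -> R -> R; Qx : R -> R -> R; Qy : R -> R -> R;
  P_diff : forall x y, differentiable_pt_lim P x y (Px x y) (Py x y);
  Q_diff : forall x y, differentiable_pt_lim Q x y (Qx x y) (Qy x y);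
  Px_cont : forall x y, continuity_2d_pt Px x y;
  Py_cont : forall x y, continuity_2d_pt Py x y;
  Qx_cont : forall x y, continuity_2d_pt Qx x y;
  Qy_cont : forall x y, continuity_2d_pt Qy x y;
  curl_eq : forall x y, Qx x y - Py x y = 2;
  min_eq : forall x y,
    Q x y ^ 2 * Px x y - Q x y * P x y * (Py x y + Qx x y) + P x y ^ 2 * Qy x y = 0
}.

(** * Composition and affine substitution in two variables *)

Lemma is_derive_comp_2d (f : R -> R -> R) (g h : R -> R) (t lx ly lg lh : R) :
  differentiable_pt_lim f (g t) (h t) lx ly ->
  is_derive g t lg -> is_derive h t lh ->
  is_derive (fun s => f (g s) (h s)) t (lx * lg + ly * lh).
Proof.
intros Hf Hg Hh; apply is_derive_Reals.
apply derivable_pt_lim_comp_2d; auto; now apply is_derive_Reals.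
Qed.

Lemma continuous_comp_2d (f : R -> R -> R) (g h : R -> R) (t : R) :
  continuity_2d_pt f (g t) (h t) -> continuous g t -> continuous h t ->
  continuous (fun s => f (g s) (h s)) t.
Proof.
intros Hf Hg Hh; apply (continuous_comp_2 g h f); auto.
now apply continuity_2d_pt_filterlim.
Qed.

Lemma continuity_2d_pt_affine (f : R -> R -> R) (x0 y0 a b x y : R) :
  continuity_2d_pt f (x0 + a * x - b * y) (y0 + b * x + a * y) ->
  continuity_2d_pt (fun x y => f (x0 + a * x - b * y) (y0 + b * x + a * y)) x y.
Proof.
intros Hf; apply continuity_2d_pt_filterlim.
apply (continuous_comp_2 (fun z : R * R => x0 + a * fst z - b * snd z)
  (fun z : R * R => y0 + b * fst z + a * snd z) f (x, y)).
- apply (continuous_minus (fun z : R * R => x0 + a * fst z) (fun z : R * R => b * snd z)).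
  + apply (continuous_plus (fun z : R * R => x0) (fun z : R * R => a * fst z)).
    * apply continuous_const.
    * apply (continuous_mult (fun z : R * R => a) fst); [apply continuous_const|apply continuous_fst].
  + apply (continuous_mult (fun z : R * R => b) snd); [apply continuous_const|apply continuous_snd].
- apply (continuous_plus (fun z : R * R => y0 + b * fst z) (fun z : R * R => a * snd z)).
  + apply (continuous_plus (fun z : R * R => y0) (fun z : R * R => b * fst z)).
    * apply continuous_const.
    * apply (continuous_mult (fun z : R * R => b) fst); [apply continuous_const|apply continuous_fst].
  + apply (continuous_mult (fun z : R * R => a) snd); [apply continuous_const|apply continuous_snd].
- now apply continuity_2d_pt_filterlim.
Qed.

Lemma differentiable_affine (c a b x y : R) :
  differentiable_pt_lim (fun x y => c + a * x + b * y) x y a b.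
Proof.
intros eps; exists (mkposreal 1 Rlt_0_1); intros u v _ _.
replace (_ - _ - _) with 0 by ring; rewrite Rabs_R0.
apply Rmult_le_pos; [apply Rlt_le, cond_pos|].
apply Rle_trans with (Rabs (u - x)); [apply Rabs_pos|apply Rmax_l].
Qed.

Lemma differentiable_lincomb (f g : R -> R -> R) (a b x y fx fy gx gy : R) :
  differentiable_pt_lim f x y fx fy -> differentiable_pt_lim g x y gx gy ->
  differentiable_pt_lim (fun x y => a * f x y + b * g x y) x y
    (a * fx + b * gx) (a * fy + b * gy).
Proof.
intros Hf Hg.
apply differentiable_pt_lim_ext with (fun x y => (fun s t => 0 + a * s + b * t) (f x y) (g x y)).
- exists (mkposreal 1 Rlt_0_1); intros; ring.
- apply (differentiable_pt_lim_comp (fun s t => 0 + a * s + b * t) f g); auto.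
  apply differentiable_affine.
Qed.

Lemma differentiable_rigid (f : R -> R -> R) (x0 y0 a b x y fx fy : R) :
  differentiable_pt_lim f (x0 + a * x - b * y) (y0 + b * x + a * y) fx fy ->
  differentiable_pt_lim (fun x y => f (x0 + a * x - b * y) (y0 + b * x + a * y)) x y
    (a * fx + b * fy) (- b * fx + a * fy).
Proof.
intros Hf.
replace (a * fx + b * fy) with (fx * a + fy * b) by ring.
replace (- b * fx + a * fy) with (fx * - b + fy * a) by ring.
apply (differentiable_pt_lim_comp f (fun x y => x0 + a * x - b * y) (fun x y => y0 + b * x + a * y));
  auto; try apply differentiable_affine.
apply differentiable_pt_lim_ext with (2 := differentiable_affine x0 a (- b) x y).
exists (mkposreal 1 Rlt_0_1); intros; ring.
Qed.

Lemma continuity_2d_lincomb (f g : R -> R -> R) (a b x y : R) :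
  continuity_2d_pt f x y -> continuity_2d_pt g x y ->
  continuity_2d_pt (fun x y => a * f x y + b * g x y) x y.
Proof.
intros Hf Hg.
apply (continuity_2d_pt_plus (fun x y => a * f x y) (fun x y => b * g x y));
 (apply (continuity_2d_pt_mult (fun x y => _)); [apply continuity_2d_pt_const|assumption]).
Qed.

Lemma P_cont (w : pminimal) x y : continuity_2d_pt (P w) x y.
Proof. apply differentiable_continuity_pt; eexists; eexists; apply P_diff. Qed.

Lemma Q_cont (w : pminimal) x y : continuity_2d_pt (Q w) x y.
Proof. apply differentiable_continuity_pt; eexists; eexists; apply Q_diff. Qed.

(** * Invariance under rigid motions *)

Section Motion.
Context (w : pminimal) (x0 y0 a b : R) (Hab : a ^ 2 + b ^ 2 = 1).
Let X (x y : R) := x0 + a * x - b * y.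
Let Y (x y : R) := y0 + b * x + a * y.
Let pull (f : R -> R -> R) x y := f (X x y) (Y x y).

(** This is the pullback of the 1-form [P dx + Q dy] under the rigid motion [(X, Y)]: the new [P]
    and [Q] are the components of F along [(a, b)] and along its normal [(- b, a)]. The proof ends
    with [Defined] so that these fields compute. *)
Definition motion : pminimal.
Proof.
refine {|
  P x y := a * pull (P w) x y + b * pull (Q w) x y;
  Q x y := - b * pull (P w) x y + a * pull (Q w) x y;
  Px x y := a * (a * pull (Px w) x y + b * pull (Py w) x y)
          + b * (a * pull (Qx w) x y + b * pull (Qy w) x y);
  Py x y := a * (- b * pull (Px w) x y + a * pull (Py w) x y)
          + b * (- b * pull (Qx w) x y + a * pull (Qy w) x y);
  Qx x y := - b * (a * pull (Px w) x y + b * pull (Py w) x y)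
          + a * (a * pull (Qx w) x y + b * pull (Qy w) x y);
  Qy x y := - b * (- b * pull (Px w) x y + a * pull (Py w) x y)
          + a * (- b * pull (Qx w) x y + a * pull (Qy w) x y) |}; intros x y.
1,2: apply differentiable_lincomb; apply differentiable_rigid; auto using P_diff, Q_diff.
1-4: repeat apply continuity_2d_lincomb; apply continuity_2d_pt_affine;
  auto using Px_cont, Py_cont, Qx_cont, Qy_cont.
(* The curl gets the factor [a ^ 2 + b ^ 2], and the left side of the equation its square. *)
- unfold pull; generalize (curl_eq w (X x y) (Y x y)); nra.
- unfold pull; generalize (min_eq w (X x y) (Y x y)).
  set (x' := X x y); set (y' := Y x y).
  set (p := P w x' y'); set (q := Q w x' y'); intros E.
  transitivity ((a ^ 2 + b ^ 2) ^ 2 * (q ^ 2 * Px w x' y' -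
    q * p * (Py w x' y' + Qx w x' y') + p ^ 2 * Qy w x' y')).
  + ring.
  + rewrite E; ring.
Defined.
End Motion.

(** * Characteristic segments *)

(** The clause for a general [F (f x) (g x)] comes last because its pattern also matches sums and
    products. *)
Ltac prove_continuous :=
  repeat match goal with
  | |- continuous (fun x => ?c) _ => apply continuous_const
  | |- continuous (fun x => x) _ => apply continuous_id
  | |- continuous (fun x => @?f x + @?g x) _ => apply (continuous_plus f g)
  | |- continuous (fun x => @?f x - @?g x) _ => apply (continuous_minus f g)
  | |- continuous (fun x => @?f x * @?g x) _ => apply (continuous_mult f g)
  | |- continuous (fun x => - @?f x) _ => apply (continuous_opp f)
  | |- continuous (fun x => ?F (@?f x) (@?g x)) _ => apply (continuous_comp_2d F f g)
  end;
  auto using P_cont, Q_cont, Px_cont, Py_cont, Qx_cont, Qy_cont.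

(** A Gronwall argument: if [|k| <= K], then [f ^ 2 * exp (2 * K * x)] is nondecreasing and
    [f ^ 2 * exp (- 2 * K * x)] is nonincreasing, so the zero at [c] spreads to the left by the
    first and to the right by the second. *)
Lemma linear_ode_unique (f k : R -> R) (a b c : R) :
  a <= c <= b ->
  (forall x, a <= x <= b -> is_derive f x (k x * f x)) ->
  (forall x, a <= x <= b -> continuous k x) ->
  f c = 0 -> forall x, a <= x <= b -> f x = 0.
Proof.
intros Hc Df Ck Fc x Hx.
destruct (continuity_ab_maj (fun x => Rabs (k x)) a b) as [M [HM _]]; [lra| |].
{ intros t Ht; apply continuity_pt_filterlim.
  apply (continuous_comp k Rabs); [now apply Ck|apply continuous_Rabs]. }
set (K := Rabs (k M)) in HM.
assert (Kb : forall t, a <= t <= b -> - K <= k t <= K).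
{ intros t Ht; apply Rabs_le_between, HM, Ht. }
assert (D : forall e t, a <= t <= b ->
  is_derive (fun x => f x ^ 2 * exp (e * x)) t ((2 * k t + e) * (f t ^ 2 * exp (e * t)))).
{ intros e t Ht; evar_last.
  - apply Derive.is_derive_mult; [apply is_derive_pow, Df, Ht|].
    instantiate (1 := e * exp (e * t)); auto_derive; auto; ring.
  - simpl; ring. }
assert (MV : forall e, exists z, a <= z <= b /\
  0 - f x ^ 2 * exp (e * x) = (2 * k z + e) * (f z ^ 2 * exp (e * z)) * (c - x)).
{ intros e.
  destruct (MVT_gen (fun x => f x ^ 2 * exp (e * x)) x c
    (fun t => (2 * k t + e) * (f t ^ 2 * exp (e * t)))) as [z [Hz E]].
  - intros t Ht; apply D; revert Ht; unfold Rmin, Rmax; destruct (Rle_dec x c); lra.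
  - intros t Ht; apply continuity_pt_filterlim.
    apply (ex_derive_continuous (fun x => f x ^ 2 * exp (e * x))).
    exists ((2 * k t + e) * (f t ^ 2 * exp (e * t))); apply D; revert Ht; unfold Rmin, Rmax; destruct (Rle_dec x c); lra.
  - exists z; split; [revert Hz; unfold Rmin, Rmax; destruct (Rle_dec x c); lra|].
    rewrite <- E, Fc; ring. }
assert (S : forall e t, 0 <= f t ^ 2 * exp (e * t)).
{ intros e t; apply Rmult_le_pos; [apply pow2_ge_0|apply Rlt_le, exp_pos]. }
assert (Z : forall e, f x ^ 2 * exp (e * x) <= 0 -> f x = 0).
{ intros e H; destruct (Req_dec (f x) 0) as [|N]; auto.
  generalize (Rmult_lt_0_compat _ _ (pow2_gt_0 _ N) (exp_pos (e * x))); lra. }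
destruct (Rle_dec x c).
- destruct (MV (2 * K)) as [z [Hz E]]; apply (Z (2 * K)).
  generalize (S (2 * K) z), (Kb z Hz); intros.
  assert (0 <= (2 * k z + 2 * K) * (f z ^ 2 * exp (2 * K * z)) * (c - x)); [|lra].
  apply Rmult_le_pos; [apply Rmult_le_pos; [lra|apply S]|lra].
- destruct (MV (- 2 * K)) as [z [Hz E]]; apply (Z (- 2 * K)).
  generalize (S (- 2 * K) z), (Kb z Hz); intros.
  assert (0 <= - (2 * k z + - 2 * K) * (f z ^ 2 * exp (- 2 * K * z)) * (x - c)); [|lra].
  apply Rmult_le_pos; [apply Rmult_le_pos; [lra|apply S]|lra].
Qed.

Section Line.
Context (w : pminimal).

(** Let [G] and [E] be the components of F along the line and normal to it. In coordinates adapted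
    to the line the equation reads [E ^ 2 * G' = (E * B - G * C) * G], a linear equation for [G] as
    long as [E] does not vanish. [G = 0] says that the lift of the line to the graph is
    Legendrian. *)
Lemma legendrian_segment (x0 y0 a b s1 s2 : R) :
  s1 <= 0 <= s2 -> a * P w x0 y0 + b * Q w x0 y0 = 0 ->
  (forall s, s1 <= s <= s2 ->
     - b * P w (x0 + a * s) (y0 + b * s) + a * Q w (x0 + a * s) (y0 + b * s) <> 0) ->
  forall s, s1 <= s <= s2 ->
    a * P w (x0 + a * s) (y0 + b * s) + b * Q w (x0 + a * s) (y0 + b * s) = 0.
Proof.
intros Hs H0 HE.
set (on (f : R -> R -> R) s := f (x0 + a * s) (y0 + b * s)).
set (G s := a * on (P w) s + b * on (Q w) s).
set (E s := - b * on (P w) s + a * on (Q w) s).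
set (B s := - b * (a * on (Px w) s + b * on (Py w) s) + a * (a * on (Qx w) s + b * on (Qy w) s)
  + (a * (- b * on (Px w) s + a * on (Py w) s) + b * (- b * on (Qx w) s + a * on (Qy w) s))).
set (C s := - b * (- b * on (Px w) s + a * on (Py w) s) + a * (- b * on (Qx w) s + a * on (Qy w) s)).
apply (linear_ode_unique G (fun s => (E s * B s - G s * C s) * / (E s * E s)) s1 s2 0); auto.
- intros s I; unfold G; evar_last.
  + apply (is_derive_plus (V := R_NormedModule) (fun s => a * on (P w) s) (fun s => b * on (Q w) s));
    apply is_derive_scal; apply is_derive_comp_2d; try (apply P_diff || apply Q_diff);
    auto_derive; auto; reflexivity.
  + specialize (HE s I); fold (on (P w) s) (on (Q w) s) in HE.
    generalize (min_eq w (x0 + a * s) (y0 + b * s)).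
    fold (on (P w) s) (on (Q w) s) (on (Px w) s) (on (Py w) s) (on (Qx w) s) (on (Qy w) s) in *.
    intros M; assert (HE' : E s <> 0) by exact HE.
    apply Rmult_eq_reg_r with (E s * E s); [|now apply Rmult_integral_contrapositive_currified].
    transitivity ((E s * B s - G s * C s) * G s); [|fold (G s); field; exact HE'].
    apply Rminus_diag_uniq.
    transitivity ((a ^ 2 + b ^ 2) ^ 2 * (on (Q w) s ^ 2 * on (Px w) s -
      on (Q w) s * on (P w) s * (on (Py w) s + on (Qx w) s) + on (P w) s ^ 2 * on (Qy w) s)).
    * unfold plus, G, E, B, C; simpl; ring.
    * rewrite M; ring.
- intros s I; unfold G, E, B, C, on.
  apply (continuous_mult (fun s => _) (fun s => / _)); [prove_continuous|].
  apply continuous_Rinv_comp; [prove_continuous|].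
  specialize (HE s I); now apply Rmult_integral_contrapositive_currified.
- unfold G, on; rewrite !Rmult_0_r, !Rplus_0_r; exact H0.
Qed.
End Line.

Section Axis.
Context (w : pminimal).

(** As u is only C2, [Py] has no derivative a priori. The characteristic through [(x0, y)] has
    direction [(1, - phi y)], and [P - phi y * Q = 0] along it; differentiating this in [y] at 0
    gives [Py / Q = m / (1 - m * s)] at [(x0 + s, 0)], which is differentiable in [s] with
    derivative [m ^ 2] at 0. *)
Lemma axis_slope_derive (x0 : R) :
  P w x0 0 = 0 -> Q w x0 0 <> 0 ->
  is_derive (fun x => Py w x 0 / Q w x 0) x0 ((Py w x0 0 / Q w x0 0) ^ 2).
Proof.
intros HP HQ; set (q := Q w x0 0) in HQ; set (m := Py w x0 0 / q).
set (phi := fun y => P w x0 y / Q w x0 y).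
assert (phi0 : phi 0 = 0) by (unfold phi; rewrite HP; unfold Rdiv; ring).
assert (Dphi : is_derive phi 0 m).
{ unfold phi; evar_last.
  - apply is_derive_div; [| |exact HQ].
    + apply (is_derive_comp_2d (P w) (fun _ => x0) (fun y => y)); [apply P_diff| |]; auto_derive; reflexivity.
    + apply (is_derive_comp_2d (Q w) (fun _ => x0) (fun y => y)); [apply Q_diff| |]; auto_derive; reflexivity.
  - fold q; rewrite HP; unfold m; field; exact HQ. }
assert (q3 : 0 < Rabs q / 3) by (generalize (Rabs_pos_lt q HQ); lra).
destruct (Q_cont w x0 0 (mkposreal _ q3)) as [[d1 d1p] H1].
destruct (P_cont w x0 0 (mkposreal _ q3)) as [[d2 d2p] H2].
assert (Cphi : continuous phi 0) by (apply (ex_derive_continuous phi); eexists; exact Dphi).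
destruct (Cphi (fun z => Rabs z < 1)) as [[d3 d3p] H3].
{ rewrite phi0; exists (mkposreal 1 Rlt_0_1); intros z Hz; revert Hz.
  unfold ball; simpl; unfold AbsRing_ball, abs, minus, plus, opp; simpl.
  now rewrite Ropp_0, Rplus_0_r. }
simpl in H1, H2, H3.
(* The halves are there because [y - phi y * s] is only bounded by [|y| + |s| < 2 * d]. *)
set (d := Rmin (Rmin d1 d2 / 2) d3).
assert (dpos : 0 < d) by (unfold d; repeat apply Rmin_pos; try lra;
  apply Rdiv_lt_0_compat; [now apply Rmin_pos|lra]).
assert (dle : d <= d1 / 2 /\ d <= d2 / 2 /\ d <= d3).
{ unfold d; generalize (Rmin_l (Rmin d1 d2 / 2) d3), (Rmin_r (Rmin d1 d2 / 2) d3),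
    (Rmin_l d1 d2), (Rmin_r d1 d2); lra. }
assert (Hphi : forall y, Rabs y < d -> Rabs (phi y) < 1).
{ intros y Hy; apply H3; unfold ball; simpl; unfold AbsRing_ball, abs, minus, plus, opp; simpl.
  rewrite Ropp_0, Rplus_0_r; lra. }
assert (HE : forall s y, Rabs s < d -> Rabs y < d ->
  phi y * P w (x0 + s) (y - phi y * s) + Q w (x0 + s) (y - phi y * s) <> 0).
{ intros s y Hs Hy.
  assert (Hy' := Hphi y Hy).
  assert (Rabs (phi y * s) <= d).
  { rewrite Rabs_mult; generalize (Rmult_le_compat_r _ _ 1 (Rabs_pos s) (Rlt_le _ _ Hy')); lra. }
  assert (Rabs (y - phi y * s) < d1 /\ Rabs (y - phi y * s) < d2).
  { generalize (Rabs_triang y (- (phi y * s))); rewrite Rabs_Ropp; unfold Rminus; lra. }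
  assert (A1 : Rabs (Q w (x0 + s) (y - phi y * s) - q) < Rabs q / 3).
  { apply H1; [replace (x0 + s - x0) with s by ring|rewrite Rminus_0_r]; lra. }
  assert (A2 : Rabs (P w (x0 + s) (y - phi y * s) - P w x0 0) < Rabs q / 3).
  { apply H2; [replace (x0 + s - x0) with s by ring|rewrite Rminus_0_r]; lra. }
  rewrite HP, Rminus_0_r in A2.
  set (p' := P w (x0 + s) (y - phi y * s)) in *; set (q' := Q w (x0 + s) (y - phi y * s)) in *.
  assert (A3 : Rabs (phi y * p') < Rabs q / 3).
  { rewrite Rabs_mult; generalize (Rmult_le_compat_r _ _ 1 (Rabs_pos p') (Rlt_le _ _ Hy')); lra. }
  revert A1 A3 q3; unfold Rabs; repeat destruct Rcase_abs; lra. }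
assert (HL : forall s y, Rabs s < d -> Rabs y < d ->
  P w (x0 + s) (y - phi y * s) - phi y * Q w (x0 + s) (y - phi y * s) = 0).
{ intros s y Hs Hy.
  (* If [Q] vanished there, the convention [/ 0 = 0] would make [phi y] zero, and [HE] would fail at
     [s = 0]. *)
  assert (Hq : Q w x0 y <> 0).
  { generalize (HE 0 y); rewrite Rabs_R0, Rplus_0_r, Rmult_0_r, Rminus_0_r.
    intros H; specialize (H dpos Hy); contradict H; unfold phi; rewrite H.
    unfold Rdiv; rewrite Rinv_0; ring. }
  generalize (legendrian_segment w x0 y 1 (- phi y) (Rmin 0 s) (Rmax 0 s)); intros H.
  rewrite <- (H (conj (Rmin_l _ _) (Rmax_l _ _))) with (s := s).
  - replace (x0 + 1 * s) with (x0 + s) by ring.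
    replace (y + - phi y * s) with (y - phi y * s) by ring; ring.
  - unfold phi; field; exact Hq.
  - intros t Ht.
    replace (x0 + 1 * t) with (x0 + t) by ring.
    replace (y + - phi y * t) with (y - phi y * t) by ring.
    replace (- - phi y) with (phi y) by ring; rewrite Rmult_1_l.
    apply HE; auto.
    revert Ht Hs; unfold Rmin, Rmax, Rabs; destruct (Rle_dec 0 s), (Rcase_abs s), (Rcase_abs t); lra.
  - split; [apply Rmin_r|apply Rmax_r]. }
(* [HL] is differentiated in [y] at 0, where [phi] vanishes and has derivative [m]. *)
assert (HD : forall s, Rabs s < d -> Py w (x0 + s) 0 * (1 - m * s) = m * Q w (x0 + s) 0).
{ intros s Hs.
  assert (D0 : is_derive (fun y => P w (x0 + s) (y - phi y * s)
      - phi y * Q w (x0 + s) (y - phi y * s)) 0 0).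
  { apply (is_derive_ext_loc (fun _ : R => 0)).
    - exists (mkposreal d dpos); intros y Hy; symmetry; apply HL; auto.
      revert Hy; unfold ball; simpl; unfold AbsRing_ball, abs, minus, plus, opp; simpl.
      now rewrite Ropp_0, Rplus_0_r.
    - apply (is_derive_const (V := R_NormedModule)). }
  assert (Dl : is_derive (fun y => y - phi y * s) 0 (1 - m * s)).
  { apply (is_derive_minus (V := R_NormedModule) (fun y => y) (fun y => phi y * s)).
    - apply (is_derive_id (K := R_AbsRing)).
    - evar_last; [apply Derive.is_derive_mult; [exact Dphi|apply (is_derive_const (V := R_NormedModule))]|].
      unfold zero; simpl; ring. }
  assert (Z : 0 - phi 0 * s = 0) by (rewrite phi0; ring).
  assert (D1 : is_derive (fun y => P w (x0 + s) (y - phi y * s)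
      - phi y * Q w (x0 + s) (y - phi y * s)) 0
      ((Px w (x0 + s) 0 * 0 + Py w (x0 + s) 0 * (1 - m * s)) -
       (m * Q w (x0 + s) 0 + phi 0 * (Qx w (x0 + s) 0 * 0 + Qy w (x0 + s) 0 * (1 - m * s))))).
  { apply (is_derive_minus (V := R_NormedModule) (fun y => P w (x0 + s) (y - phi y * s))).
    - apply (is_derive_comp_2d (P w) (fun _ => x0 + s)); auto.
      + rewrite Z; apply P_diff.
      + apply (is_derive_const (V := R_NormedModule)).
    - evar_last.
      + apply Derive.is_derive_mult; [exact Dphi|].
        apply (is_derive_comp_2d (Q w) (fun _ => x0 + s)); [|apply (is_derive_const (V := R_NormedModule))|exact Dl].
        rewrite Z; apply Q_diff.
      + cbv beta; rewrite Z; reflexivity. }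
  apply is_derive_unique in D0; apply is_derive_unique in D1.
  rewrite D0, phi0 in D1; lra. }
assert (HM : forall x, Rabs (x - x0) < d -> m / (1 - m * (x - x0)) = Py w x 0 / Q w x 0).
{ intros x Hx.
  assert (Hq := HE (x - x0) 0 Hx); rewrite Rabs_R0 in Hq; specialize (Hq dpos).
  rewrite phi0 in Hq; replace (0 - 0 * (x - x0)) with 0 in Hq by ring.
  rewrite Rmult_0_l, Rplus_0_l in Hq.
  assert (H := HD _ Hx); replace (x0 + (x - x0)) with x in * by ring.
  (* Otherwise [m * Q = 0], so [m = 0] and the factor would be 1. *)
  assert (N : 1 - m * (x - x0) <> 0).
  { intros N; rewrite N, Rmult_0_r in H; symmetry in H.
    apply Rmult_integral in H; destruct H as [H|H]; [rewrite H in N; lra|auto]. }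
  apply Rmult_eq_reg_r with (Q w x 0 * (1 - m * (x - x0))).
  + transitivity (m * Q w x 0); [field; exact N|rewrite <- H; field; exact Hq].
  + now apply Rmult_integral_contrapositive_currified. }
apply (is_derive_ext_loc (fun x => m / (1 - m * (x - x0)))).
- exists (mkposreal d dpos); exact HM.
- replace (Py w x0 0 / Q w x0 0) with m by reflexivity.
  auto_derive; [lra|]; field; lra.
Qed.

(** The Riccati equation [k' = k ^ 2] for [k = Py / Q] is integrated first, then [Q], whose
    derivative is [Py + 2]. Both results are kept multiplied by [1 - m * x], so that this factor
    need not be shown nonzero. *)
Lemma axis_profile (a b : R) :
  a <= 0 <= b -> P w 0 0 = 0 -> (forall x, a <= x <= b -> Q w x 0 <> 0) ->
  let d := Q w 0 0 in let m := Py w 0 0 / d in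
  forall x, a <= x <= b ->
    P w x 0 = 0 /\ Py w x 0 * (1 - m * x) = m * Q w x 0 /\
    Q w x 0 * (1 - m * x) = d + 2 * x - m * x ^ 2.
Proof.
intros Hab P0 HQ d m.
assert (HP : forall x, a <= x <= b -> P w x 0 = 0).
{ intros x Hx; generalize (legendrian_segment w 0 0 1 0 a b Hab); intros H.
  generalize (H ltac:(lra)); clear H; intros H.
  assert (HE : forall s, a <= s <= b ->
    - 0 * P w (0 + 1 * s) (0 + 0 * s) + 1 * Q w (0 + 1 * s) (0 + 0 * s) <> 0).
  { intros s Hs; replace (0 + 1 * s) with s by ring; replace (0 + 0 * s) with 0 by ring.
    specialize (HQ s Hs); contradict HQ; lra. }
  specialize (H HE x Hx); revert H.
  replace (0 + 1 * x) with x by ring; replace (0 + 0 * x) with 0 by ring; lra. }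
set (k := fun x => Py w x 0 / Q w x 0).
assert (Dk : forall x, a <= x <= b -> is_derive k x (k x ^ 2)).
{ intros x Hx; apply axis_slope_derive; auto. }
assert (Hd : d <> 0) by (apply HQ; lra).
assert (A : forall x, a <= x <= b -> k x * (1 - m * x) - m = 0).
(* The derivative is [k ^ 2 * (1 - m * x) - k * m], that is, [k] times the function itself. *)
{ apply (linear_ode_unique (fun x => k x * (1 - m * x) - m) k a b 0); auto.
  - intros x Hx; evar_last.
    + apply (is_derive_minus (V := R_NormedModule) (fun x => k x * (1 - m * x)) (fun _ => m));
        [|apply (is_derive_const (V := R_NormedModule))].
      apply Derive.is_derive_mult; [apply Dk, Hx|].
      instantiate (1 := - m); auto_derive; auto; ring.
    + unfold minus, plus, opp, zero; simpl; ring.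
  - intros x Hx; apply (ex_derive_continuous k); eexists; apply Dk, Hx.
  - unfold k; fold d; fold m; ring. }
assert (A' : forall x, a <= x <= b -> Py w x 0 * (1 - m * x) = m * Q w x 0).
{ intros x Hx; generalize (A x Hx); unfold k; intros E.
  replace m with (Py w x 0 / Q w x 0 * (1 - m * x)) at 2 by lra.
  field; auto. }
intros x Hx; repeat split; auto.
apply Rminus_diag_uniq; revert x Hx.
(* With coefficient 0: since [Qx = Py + 2], [A'] gives [Q * (1 - m * x)] the derivative
   [2 * (1 - m * x)]. *)
apply (linear_ode_unique _ (fun _ => 0) a b 0); auto.
- intros x Hx; evar_last.
  + apply (is_derive_minus (V := R_NormedModule) (fun x => Q w x 0 * (1 - m * x))
      (fun x => d + 2 * x - m * x ^ 2)).
    * apply Derive.is_derive_mult.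
      -- apply (is_derive_comp_2d (Q w) (fun x => x) (fun _ => 0)); [apply Q_diff| |]; auto_derive; reflexivity.
      -- instantiate (1 := - m); auto_derive; auto; ring.
    * auto_derive; auto; reflexivity.
  + unfold minus, plus, opp; simpl.
    generalize (A' x Hx), (curl_eq w x 0); intros; nra.
- intros; apply continuous_const.
- fold d; ring.
Qed.
End Axis.

(** * First zeros and increments of real functions *)

Lemma first_zero (f : R -> R) (b : R) :
  (forall x, continuous f x) -> 0 < f 0 -> 0 <= b -> f b <= 0 ->
  exists z, 0 < z <= b /\ f z = 0 /\ forall x, 0 <= x < z -> 0 < f x.
Proof.
intros Cf F0 Hb Fb.
assert (loc : forall x e, 0 < e -> exists d, 0 < d /\ forall y, Rabs (y - x) < d -> Rabs (f y - f x) < e).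
{ intros x e He; destruct (proj1 (filterlim_locally _ _) (Cf x) (mkposreal e He)) as [[d Hd] H].
  exists d; split; [exact Hd|intros y Hy; apply (H y Hy)]. }
(* The first zero is the supremum of the points up to which [f] stays positive. *)
set (E x := 0 <= x <= b /\ forall t, 0 <= t <= x -> 0 < f t).
destruct (completeness E) as [z [Ub Lub]].
- exists b; intros x [Hx _]; lra.
- exists 0; split; [lra|]; intros t Ht; now replace t with 0 by lra.
- assert (z0 : 0 <= z).
  { apply Ub; split; [lra|]; intros t Ht; now replace t with 0 by lra. }
  assert (zb : z <= b) by (apply Lub; intros x [Hx _]; lra).
  assert (pos : forall x, 0 <= x < z -> 0 < f x).
  { intros x Hx; apply Rnot_le_lt; intros Fx.
    apply (Rlt_not_le z x); [lra|].
    apply Lub; intros t [Ht H]; apply Rnot_lt_le; intros L; specialize (H x); lra. }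
  assert (fz : f z = 0).
  { destruct (Rtotal_order (f z) 0) as [N|[Z|Z]]; auto.
    - assert (z <> 0) by (intros ->; lra).
      destruct (loc z (- f z)) as [d [Hd H1]]; [lra|].
      set (x := Rmax 0 (z - d / 2)).
      assert (0 <= x < z /\ z - x < d).
      { unfold x, Rmax; destruct (Rle_dec 0 (z - d / 2)); lra. }
      assert (Hx := pos x ltac:(lra)).
      specialize (H1 x); rewrite Rabs_minus_sym, Rabs_pos_eq in H1; [|lra].
      specialize (H1 ltac:(lra)); apply Rabs_lt_between in H1; lra.
    - destruct (loc z (f z) Z) as [d [Hd H1]].
      assert (z < b) by (destruct zb; auto; subst; lra).
      set (x := Rmin b (z + d / 2)).
      assert (z < x <= b /\ x - z < d).
      { unfold x, Rmin; destruct (Rle_dec b (z + d / 2)); lra. }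
      assert (E x); [|generalize (Ub x ltac:(auto)); lra].
      split; [lra|]; intros t Ht; destruct (Rlt_le_dec t z); [apply pos; lra|].
      specialize (H1 t); rewrite Rabs_pos_eq in H1; [|lra].
      specialize (H1 ltac:(lra)); apply Rabs_lt_between in H1; lra. }
  exists z; repeat split; auto.
  destruct z0 as [|<-]; auto; lra.
Qed.

Lemma first_zero_left (f : R -> R) (a : R) :
  (forall x, continuous f x) -> 0 < f 0 -> a <= 0 -> f a <= 0 ->
  exists z, a <= z < 0 /\ f z = 0 /\ forall x, z < x <= 0 -> 0 < f x.
Proof.
intros Cf F0 Ha Fa.
destruct (first_zero (fun x => f (- x)) (- a)) as [z [Hz [E H]]].
- intros x; apply (continuous_comp (fun x => - x) f); [|apply Cf].
  apply (ex_derive_continuous (fun x => - x)); auto_derive; auto.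
- now rewrite Ropp_0.
- lra.
- now rewrite Ropp_involutive.
- exists (- z); repeat split; try lra; auto.
  intros x Hx; replace x with (- - x) by ring; apply H; lra.
Qed.

Lemma continuous_zero_left (f : R -> R) (a b : R) :
  continuous f a -> a < b -> (forall x, a < x < b -> f x = 0) -> f a = 0.
Proof.
intros Cf Hab H; apply Rabs_eq_0, Rle_antisym; [|apply Rabs_pos].
apply le_epsilon; intros e He; rewrite Rplus_0_l.
destruct (proj1 (filterlim_locally _ _) Cf (mkposreal e He)) as [[d Hd] H1].
set (x := a + Rmin d (b - a) / 2).
assert (a < x < b /\ x - a < d).
{ unfold x, Rmin; destruct (Rle_dec d (b - a)); lra. }
specialize (H1 x).
assert (B : ball a d x).
{ change (Rabs (x - a) < d); rewrite Rabs_pos_eq; lra. }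
specialize (H1 B); change (Rabs (f x - f a) < e) in H1.
rewrite (H x) in H1 by lra; rewrite Rminus_0_l, Rabs_Ropp in H1; lra.
Qed.

Lemma increment_ge (f df : R -> R) (a b : R) :
  a <= b -> (forall x, is_derive f x (df x)) -> (forall x, a < x < b -> 1 <= df x) ->
  b - a <= f b - f a.
Proof.
intros [Hab|<-] Df H; [|lra].
destruct (MVT_cor2 f df a b Hab) as [c [E Hc]].
- intros c _; apply is_derive_Reals, Df.
- rewrite E; generalize (H c Hc); nra.
Qed.

(** * Characteristic rays *)

Section Rays.
Context (w : pminimal).

Lemma Q_axis_derive (x : R) : is_derive (fun x => Q w x 0) x (Qx w x 0).
Proof.
evar_last.
- apply (is_derive_comp_2d (Q w) (fun x => x) (fun _ => 0)); [apply Q_diff| |]; auto_derive; reflexivity.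
- simpl; ring.
Qed.

Lemma P_axis_derive (x : R) : is_derive (fun x => P w x 0) x (Px w x 0).
Proof.
evar_last.
- apply (is_derive_comp_2d (P w) (fun x => x) (fun _ => 0)); [apply P_diff| |]; auto_derive; reflexivity.
- simpl; ring.
Qed.

(** [Q] may vanish at [a]; the relations reach this end by continuity, so they can be evaluated at a
    singular point. *)
Lemma axis_profile_left (a : R) :
  a < 0 -> P w 0 0 = 0 -> (forall x, a < x <= 0 -> 0 < Q w x 0) ->
  let d := Q w 0 0 in let m := Py w 0 0 / d in
  forall x, a <= x <= 0 ->
    P w x 0 = 0 /\ Py w x 0 * (1 - m * x) = m * Q w x 0 /\
    Q w x 0 * (1 - m * x) = d + 2 * x - m * x ^ 2.
Proof.
intros Ha P0 HQ d m.
assert (I : forall x, a < x <= 0 ->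
    P w x 0 = 0 /\ Py w x 0 * (1 - m * x) = m * Q w x 0 /\
    Q w x 0 * (1 - m * x) = d + 2 * x - m * x ^ 2).
{ intros x Hx; apply (axis_profile w x 0); try lra.
  intros t Ht; apply Rgt_not_eq, HQ; lra. }
intros x [[Hx|<-] Hx']; [apply I; lra|].
repeat split.
- apply (continuous_zero_left (fun x => P w x 0) a 0); auto; [prove_continuous|].
  intros y Hy; apply I; lra.
- apply Rminus_diag_uniq.
  apply (continuous_zero_left (fun x => Py w x 0 * (1 - m * x) - m * Q w x 0) a 0); auto; [prove_continuous|].
  intros y Hy; apply Rminus_diag_eq, I; lra.
- apply Rminus_diag_uniq.
  (* [x * (x * 1)] is [x ^ 2] unfolded, since [prove_continuous] has no clause for powers. *)
  apply (continuous_zero_left (fun x => Q w x 0 * (1 - m * x) - (d + 2 * x - m * (x * (x * 1)))) a 0); auto; [prove_continuous|].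
  intros y Hy; apply Rminus_diag_eq, I; lra.
Qed.

(* If the slope were below 1, the profile would blow up at x = 1/m before reaching a zero. *)
Lemma axis_slope_ge_0 : P w 0 0 = 0 -> 0 < Q w 0 0 -> 1 <= Qx w 0 0.
Proof.
intros P0 Q0; apply Rnot_lt_le; intros L.
assert (Lp : Py w 0 0 < -1) by (generalize (curl_eq w 0 0); lra).
set (d := Q w 0 0) in *; set (m := Py w 0 0 / d).
assert (md : m * d < -1) by (unfold m, Rdiv; rewrite Rmult_assoc, Rinv_l; lra).
assert (m0 : m < 0) by nra.
(* Multiplying by [- m > 0] and completing the square leaves the remainder [- m * d - 1 > 0]. *)
assert (pos : forall x, 0 < d + 2 * x - m * x ^ 2).
{ intros x; assert (0 < - m * (d + 2 * x - m * x ^ 2)); [|nra].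
  replace (- m * (d + 2 * x - m * x ^ 2)) with ((m * x - 1) ^ 2 + (- m * d - 1)) by ring.
  generalize (pow2_ge_0 (m * x - 1)); lra. }
assert (im : / m < 0) by now apply Rinv_lt_0_compat.
assert (mi : m * / m = 1) by (apply Rinv_r; lra).
(* Going left from 0, stop at the first zero of [Q] or, failing that, at [/ m]: in both cases the
   left side of the profile vanishes, against [pos]. *)
assert (Z : exists z, / m <= z < 0 /\ Q w z 0 * (1 - m * z) = 0 /\ forall x, z < x <= 0 -> 0 < Q w x 0).
{ destruct (classic (exists x, / m < x <= 0 /\ Q w x 0 <= 0)) as [[x [Hx Qx0]]|N].
  - destruct (first_zero_left (fun x => Q w x 0) x) as [z [Hz [E H]]]; auto; try lra.
    + intros t; prove_continuous.
    + exists z; rewrite E; repeat split; auto; lra.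
  - exists (/ m); rewrite mi; repeat split; try lra.
    intros x Hx; apply Rnot_le_lt; intros Hn; apply N; exists x; auto. }
destruct Z as [z [Hz [E H]]].
generalize (axis_profile_left z (proj2 Hz) P0 H z); fold d; fold m; intros A.
destruct A as [_ [_ A]]; [lra|].
generalize (pos z); lra.
Qed.
End Rays.

Lemma axis_slope_ge (w : pminimal) (x : R) : P w x 0 = 0 -> 0 < Q w x 0 -> 1 <= Qx w x 0.
Proof.
intros HP HQ.
assert (I : 1 ^ 2 + 0 ^ 2 = 1) by ring.
generalize (axis_slope_ge_0 (motion w x 0 1 0 I)); simpl.
replace (x + 1 * 0 - 0 * 0) with x by ring; replace (0 + 0 * 0 + 1 * 0) with 0 by ring.
intros H; lra.
Qed.

(** While [Q > 0] the axis stays characteristic and [Q] grows with slope at least 1. So [Q] cannot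
    vanish to the right, and to the left it must vanish within distance [Q w 0 0]. *)
Lemma axis_ray (w : pminimal) : P w 0 0 = 0 -> 0 < Q w 0 0 ->
  exists z, - Q w 0 0 <= z < 0 /\
    (forall x, z <= x -> P w x 0 = 0 /\ x - z <= Q w x 0) /\
    Q w z 0 = 0 /\ Px w z 0 = 0 /\ (Qx w z 0 = 1 \/ Qx w z 0 = 2).
Proof.
intros P0 Q0; set (d := Q w 0 0) in *.
assert (seg : forall a b, a <= 0 <= b -> (forall x, a <= x <= b -> 0 < Q w x 0) ->
  forall x, a <= x <= b -> P w x 0 = 0).
{ intros a b Hab HQ x Hx; apply (axis_profile w a b); auto.
  intros t Ht; apply Rgt_not_eq, HQ, Ht. }
assert (CQ : forall x, continuous (fun x => Q w x 0) x) by (intros; prove_continuous).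
assert (Z : exists z, - d <= z < 0 /\ Q w z 0 = 0 /\ forall x, z < x <= 0 -> 0 < Q w x 0).
{ destruct (classic (exists x, - d <= x <= 0 /\ Q w x 0 <= 0)) as [[x [Hx Qx0]]|N].
  - destruct (first_zero_left (fun x => Q w x 0) x) as [z [Hz [E H]]]; auto; try lra.
    exists z; repeat split; auto; lra.
  - assert (H : forall x, - d <= x <= 0 -> 0 < Q w x 0).
    { intros x Hx; apply Rnot_le_lt; intros Hn; apply N; exists x; auto. }
    exfalso; apply N; exists (- d); split; [lra|].
    generalize (increment_ge (fun x => Q w x 0) (fun x => Qx w x 0) (- d) 0); intros G.
    fold d in G; enough (0 - - d <= d - Q w (- d) 0) by lra.
    apply G; [lra|apply Q_axis_derive|].
    intros x Hx; apply axis_slope_ge; [|apply H; lra].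
    apply (seg (- d) 0); auto; lra. }
destruct Z as [z [Hz [Qz posl]]].
assert (posr : forall x, 0 <= x -> 0 < Q w x 0).
{ intros b Hb; apply Rnot_le_lt; intros N.
  destruct (first_zero (fun x => Q w x 0) b) as [y [Hy [E H]]]; auto.
  generalize (increment_ge (fun x => Q w x 0) (fun x => Qx w x 0) 0 y); intros G.
  enough (L : y - 0 <= Q w y 0 - Q w 0 0) by (fold d in L; lra).
  apply G; [lra|apply Q_axis_derive|].
  intros x Hx; apply axis_slope_ge; [|apply H; lra].
  apply (seg 0 x); try lra; intros t Ht; apply H; lra. }
assert (pos : forall x, z < x -> 0 < Q w x 0).
{ intros x Hx; destruct (Rle_dec 0 x); [apply posr|apply posl]; lra. }
assert (HP : forall x, z < x -> P w x 0 = 0).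
{ intros x Hx; apply (seg (Rmin x 0) (Rmax x 0)).
  - split; [apply Rmin_r|apply Rmax_r].
  - intros t Ht; apply pos; revert Ht; unfold Rmin; destruct (Rle_dec x 0); lra.
  - split; [apply Rmin_l|apply Rmax_l]. }
assert (HPz : P w z 0 = 0).
{ apply (continuous_zero_left (fun x => P w x 0) z 0); [prove_continuous|lra|].
  intros x Hx; apply HP; lra. }
exists z; split; [lra|]; split; [|split; [exact Qz|split]].
- intros x Hx; split.
  + destruct Hx as [Hx|<-]; auto.
  + generalize (increment_ge (fun x => Q w x 0) (fun x => Qx w x 0) z x Hx); rewrite Qz; intros G.
    enough (x - z <= Q w x 0 - 0) by lra; apply G; [apply Q_axis_derive|].
    intros t Ht; apply axis_slope_ge; [apply HP|apply pos]; lra.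
(* [P] vanishes on the axis to the right of [z], hence so does [Px], and then [Px] at [z] by
   continuity. *)
- apply (continuous_zero_left (fun x => Px w x 0) z 0); [prove_continuous|lra|].
  intros x Hx; rewrite <- (is_derive_unique _ _ _ (P_axis_derive w x)).
  apply is_derive_unique, (is_derive_ext_loc (fun _ : R => 0)); [|apply (is_derive_const (V := R_NormedModule))].
  assert (xz : 0 < x - z) by lra.
  exists (mkposreal _ xz); intros y Hy; symmetry; apply HP.
  change (Rabs (y - x) < x - z) in Hy; apply Rabs_lt_between in Hy; lra.
- generalize (axis_profile_left w z (proj2 Hz) P0 posl); cbv zeta.
  fold d; set (m := Py w 0 0 / d); intros A.
  destruct (A z) as [_ [A1 A2]]; [lra|]; rewrite Qz in A1, A2.
  rewrite Rmult_0_r in A1; rewrite Rmult_0_l in A2.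
  generalize (curl_eq w z 0); intros C.
  (* If [Py] vanishes at [z], the curl equation gives slope 2. If [m * z = 1], the profile forces
     [z = - d] and [m * Q = - (1 - m * x)], so [Py = -1] along the axis and the slope is 1. *)
  apply Rmult_integral in A1; destruct A1 as [A1|A1]; [right; lra|left].
  assert (zd : z = - d) by nra.
  enough (Py w z 0 + 1 = 0) by lra.
  apply (continuous_zero_left (fun x => Py w x 0 + 1) z 0); [prove_continuous|lra|].
  intros x Hx; destruct (A x) as [_ [B1 B2]]; [lra|].
  assert (md : m * d = -1) by (rewrite zd in A1; lra).
  assert (N : 0 < 1 - m * x).
  { assert (0 < d * (1 - m * x)) by (replace (d * (1 - m * x)) with (d - (m * d) * x) by ring; rewrite md; lra).
    nra. }
  assert (B3 : m * Q w x 0 * (1 - m * x) = - (1 - m * x) * (1 - m * x)).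
  { rewrite Rmult_assoc, B2.
    replace (m * (d + 2 * x - m * x ^ 2)) with (m * d + 2 * (m * x) - (m * x) ^ 2) by ring.
    rewrite md; ring. }
  apply Rmult_eq_reg_r in B3; [|lra].
  rewrite B3 in B1; apply Rmult_eq_reg_r with (1 - m * x); lra.
Qed.

Lemma unit_vector_Rabs_le (a b : R) : a ^ 2 + b ^ 2 = 1 -> Rabs a <= 1 /\ Rabs b <= 1.
Proof. intros H; split; apply Rabs_le; nra. Qed.

(** This is [axis_ray] in the frame at [(x, y)] whose first axis is the direction [(Q, - P) / |F|].
    The ray starts at the singular point [(x0, y0)], and [mu] is the slope of the normal component
    there. *)
Lemma characteristic_ray (w : pminimal) (x y : R) :
  ~ (P w x y = 0 /\ Q w x y = 0) ->
  exists a b t x0 y0 mu, a ^ 2 + b ^ 2 = 1 /\ 0 < t <= Rabs (P w x y) + Rabs (Q w x y) /\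
    x = x0 + a * t /\ y = y0 + b * t /\ P w x0 y0 = 0 /\ Q w x0 y0 = 0 /\
    (forall s, 0 <= s -> a * P w (x0 + a * s) (y0 + b * s) + b * Q w (x0 + a * s) (y0 + b * s) = 0 /\
       s <= - b * P w (x0 + a * s) (y0 + b * s) + a * Q w (x0 + a * s) (y0 + b * s)) /\
    (mu = 1 \/ mu = 2) /\
    a * Px w x0 y0 + b * Py w x0 y0 = - mu * b /\ a * Qx w x0 y0 + b * Qy w x0 y0 = mu * a.
Proof.
intros N; set (p := P w x y) in *; set (q := Q w x y) in *.
assert (pos : 0 < p ^ 2 + q ^ 2).
{ destruct (Req_dec p 0) as [->|Hp].
  - destruct (Req_dec q 0) as [->|Hq]; [exfalso; auto|].
    generalize (pow2_gt_0 q Hq); lra.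
  - generalize (pow2_gt_0 p Hp), (pow2_ge_0 q); lra. }
set (d := sqrt (p ^ 2 + q ^ 2)).
assert (dpos : 0 < d) by now apply sqrt_lt_R0.
assert (dd : d ^ 2 = p ^ 2 + q ^ 2) by (apply pow2_sqrt; lra).
assert (dle : d <= Rabs p + Rabs q).
{ apply Rsqr_incr_0_var; [|generalize (Rabs_pos p), (Rabs_pos q); lra].
  unfold Rsqr; replace (d * d) with (d ^ 2) by ring; rewrite dd.
  rewrite <- (pow2_abs p), <- (pow2_abs q).
  generalize (Rabs_pos p), (Rabs_pos q); nra. }
(* In this frame F becomes [(0, d)] at the origin. *)
set (a := q / d); set (b := - p / d).
assert (Hab : a ^ 2 + b ^ 2 = 1).
{ unfold a, b; replace ((q / d) ^ 2 + (- p / d) ^ 2) with ((p ^ 2 + q ^ 2) / d ^ 2) by (field; lra).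
  rewrite dd; field; lra. }
assert (E0 : P (motion w x y a b Hab) 0 0 = 0).
{ simpl; replace (x + a * 0 - b * 0) with x by ring; replace (y + b * 0 + a * 0) with y by ring.
  fold p q; unfold a, b; field; lra. }
assert (E1 : Q (motion w x y a b Hab) 0 0 = d).
{ simpl; replace (x + a * 0 - b * 0) with x by ring; replace (y + b * 0 + a * 0) with y by ring.
  fold p q; unfold a, b; apply Rmult_eq_reg_r with d; [|lra].
  replace (d * d) with (p ^ 2 + q ^ 2) by (rewrite <- dd; ring); field; lra. }
destruct (axis_ray (motion w x y a b Hab)) as [z [Hz [H [Qz [Pxz Qxz]]]]]; auto; [lra|].
rewrite E1 in Hz.
destruct (H z (Rle_refl z)) as [Pz _].
exists a, b, (- z), (x + a * z), (y + b * z), (Qx (motion w x y a b Hab) z 0).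
cbn [P Q Px Qx motion] in *.
replace (x + a * z - b * 0) with (x + a * z) in * by ring.
replace (y + b * z + a * 0) with (y + b * z) in * by ring.
set (p0 := P w (x + a * z) (y + b * z)) in *.
set (q0 := Q w (x + a * z) (y + b * z)) in *.
repeat split; auto; try lra.
(* [P] and [Q] are recovered from the rotated components by the inverse rotation; the derivatives
   below are treated in the same way. *)
- transitivity (a * (a * p0 + b * q0) - b * (- b * p0 + a * q0)).
  + replace p0 with ((a ^ 2 + b ^ 2) * p0) at 1 by (rewrite Hab; ring); ring.
  + rewrite Pz, Qz; ring.
- transitivity (b * (a * p0 + b * q0) + a * (- b * p0 + a * q0)).
  + replace q0 with ((a ^ 2 + b ^ 2) * q0) at 1 by (rewrite Hab; ring); ring.
  + rewrite Pz, Qz; ring.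
- destruct (H (z + s)) as [H1 _]; [lra|].
  replace (x + a * z + a * s) with (x + a * (z + s) - b * 0) by ring.
  replace (y + b * z + b * s) with (y + b * (z + s) + a * 0) by ring; exact H1.
- destruct (H (z + s)) as [_ H1]; [lra|].
  replace (x + a * z + a * s) with (x + a * (z + s) - b * 0) by ring.
  replace (y + b * z + b * s) with (y + b * (z + s) + a * 0) by ring; lra.
- set (u := a * Px w _ _ + b * Py w _ _) in *; set (v := a * Qx w _ _ + b * Qy w _ _) in *.
  transitivity ((a ^ 2 + b ^ 2) * u); [rewrite Hab; ring|].
  transitivity (a * (a * u + b * v) - b * (- b * u + a * v)); [ring|rewrite Pxz; ring].
- set (u := a * Px w _ _ + b * Py w _ _) in *; set (v := a * Qx w _ _ + b * Qy w _ _) in *.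
  transitivity ((a ^ 2 + b ^ 2) * v); [rewrite Hab; ring|].
  transitivity (b * (a * u + b * v) + a * (- b * u + a * v)); [ring|rewrite Pxz; ring].
Qed.

(** * Nondegenerate singular points *)

Section Nondegenerate.
Context (w : pminimal) (x0 y0 : R) (P0 : P w x0 y0 = 0) (Q0 : Q w x0 y0 = 0).
Context (det : Px w x0 y0 * Qy w x0 y0 - Py w x0 y0 * Qx w x0 y0 <> 0).

(** At a nearby zero the linear part of F is bounded by [e * M], where [M] is the sup norm of the
    displacement. Cramer's rule turns this into [delta * M <= delta / 2 * M], hence [M = 0]. *)
Lemma nondegenerate_isolated : exists r, 0 < r /\ forall x y,
  Rabs (x - x0) < r -> Rabs (y - y0) < r -> P w x y = 0 -> Q w x y = 0 -> x = x0 /\ y = y0.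
Proof.
set (A := Px w x0 y0) in *; set (B := Py w x0 y0) in *.
set (C := Qx w x0 y0) in *; set (D := Qy w x0 y0) in *.
set (K := Rabs A + Rabs B + Rabs C + Rabs D + 1).
assert (K0 : 0 < K) by (unfold K; generalize (Rabs_pos A), (Rabs_pos B), (Rabs_pos C), (Rabs_pos D); lra).
assert (dp := Rabs_pos_lt _ det); set (delta := Rabs (A * D - B * C)) in dp.
assert (e0 : 0 < delta / (2 * K)) by (apply Rdiv_lt_0_compat; lra).
(* [K] bounds the coefficient sums in Cramer's rule, so that the errors add up to half the
   determinant. *)
set (e := delta / (2 * K)) in e0.
assert (eK : e * K = delta / 2) by (unfold e; field; lra).
destruct (P_diff w x0 y0 (mkposreal e e0)) as [[r1 r1p] H1].
destruct (Q_diff w x0 y0 (mkposreal e e0)) as [[r2 r2p] H2].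
simpl in H1, H2.
exists (Rmin r1 r2); split; [now apply Rmin_pos|].
intros x y Hx Hy Hp Hq.
assert (G1 := Rmin_l r1 r2); assert (G2 := Rmin_r r1 r2).
specialize (H1 x y ltac:(lra) ltac:(lra)); specialize (H2 x y ltac:(lra) ltac:(lra)).
rewrite Hp, P0 in H1; rewrite Hq, Q0 in H2; fold A B in H1; fold C D in H2.
set (h := x - x0) in *; set (k := y - y0) in *; set (M := Rmax (Rabs h) (Rabs k)) in *.
rewrite Rminus_0_r, Rminus_0_l, Rabs_Ropp in H1, H2.
assert (M0 : 0 <= M) by (apply Rle_trans with (Rabs h); [apply Rabs_pos|apply Rmax_l]).
assert (bound : forall u v c1 c2, Rabs u <= e * M -> Rabs v <= e * M ->
  Rabs c1 + Rabs c2 <= K -> Rabs (c1 * u - c2 * v) <= delta / 2 * M).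
{ intros u v c1 c2 Hu Hv Hc; rewrite <- eK.
  apply Rle_trans with (Rabs c1 * Rabs u + Rabs c2 * Rabs v).
  - rewrite <- !Rabs_mult; unfold Rminus; eapply Rle_trans; [apply Rabs_triang|].
    rewrite Rabs_Ropp; lra.
  - apply Rle_trans with (Rabs c1 * (e * M) + Rabs c2 * (e * M)).
    + apply Rplus_le_compat; apply Rmult_le_compat_l; auto using Rabs_pos.
    + rewrite <- Rmult_plus_distr_r.
      replace (e * K * M) with (K * (e * M)) by ring.
      apply Rmult_le_compat_r; [apply Rmult_le_pos; lra|exact Hc]. }
assert (Bh : delta * Rabs h <= delta / 2 * M).
{ unfold delta at 1; rewrite <- Rabs_mult.
  replace ((A * D - B * C) * h) with (D * (A * h + B * k) - B * (C * h + D * k)) by ring.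
  apply bound; auto; unfold K; generalize (Rabs_pos A), (Rabs_pos C); lra. }
assert (Bk : delta * Rabs k <= delta / 2 * M).
{ unfold delta at 1; rewrite <- Rabs_mult.
  replace ((A * D - B * C) * k) with (A * (C * h + D * k) - C * (A * h + B * k)) by ring.
  apply bound; auto; unfold K; generalize (Rabs_pos B), (Rabs_pos D); lra. }
assert (MM : delta * M <= delta / 2 * M).
{ unfold M at 1, Rmax; destruct (Rle_dec (Rabs h) (Rabs k)); auto. }
assert (Mz : M = 0) by nra.
assert (hz : Rabs h <= 0) by (rewrite <- Mz; apply Rmax_l).
assert (kz : Rabs k <= 0) by (rewrite <- Mz; apply Rmax_r).
unfold h, k in *; clear - hz kz.
revert hz kz; unfold Rabs; destruct (Rcase_abs (x - x0)), (Rcase_abs (y - y0)); lra.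
Qed.

(** Near the singular point F is small, so the ray through a nearby point starts close by, hence at
    the isolated singular point itself. That ray is radial and extends to infinity, so it also
    passes through [(x0 + h, y0 + k)]. *)
Lemma nondegenerate_radial (h k : R) : h * P w (x0 + h) (y0 + k) + k * Q w (x0 + h) (y0 + k) = 0.
Proof.
destruct nondegenerate_isolated as [r [rp iso]].
destruct (classic (h = 0 /\ k = 0)) as [[-> ->]|N]; [ring|].
assert (r4 : 0 < r / 4) by lra.
destruct (P_cont w x0 y0 (mkposreal _ r4)) as [[d1 d1p] H1].
destruct (Q_cont w x0 y0 (mkposreal _ r4)) as [[d2 d2p] H2]; simpl in H1, H2.
rewrite P0 in H1; rewrite Q0 in H2.
set (d := Rmin (Rmin d1 d2) (r / 2)).
assert (Hd : 0 < d /\ d <= d1 /\ d <= d2 /\ d <= r / 2).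
{ unfold d; repeat split; [repeat apply Rmin_pos; lra| | |apply Rmin_r];
  (eapply Rle_trans; [apply Rmin_l|]); [apply Rmin_l|apply Rmin_r]. }
set (n := Rabs h + Rabs k + 1).
assert (n0 : 0 < n) by (unfold n; generalize (Rabs_pos h), (Rabs_pos k); lra).
(* Shrinking [(h, k)] by [e] brings the point within [d] of the singular point in the sup norm. *)
set (e := d / n).
assert (e0 : 0 < e) by (apply Rdiv_lt_0_compat; lra).
assert (en : e * n = d) by (unfold e; field; lra).
assert (Hh : Rabs (e * h) < d).
{ rewrite Rabs_mult, (Rabs_pos_eq e), <- en by lra; apply Rmult_lt_compat_l; auto.
  unfold n; generalize (Rabs_pos k); lra. }
assert (Hk : Rabs (e * k) < d).
{ rewrite Rabs_mult, (Rabs_pos_eq e), <- en by lra; apply Rmult_lt_compat_l; auto.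
  unfold n; generalize (Rabs_pos h); lra. }
set (x := x0 + e * h); set (y := y0 + e * k).
assert (Hx : x - x0 = e * h) by (unfold x; ring).
assert (Hy : y - y0 = e * k) by (unfold y; ring).
assert (NF : ~ (P w x y = 0 /\ Q w x y = 0)).
{ intros [Hp Hq]; apply N.
  destruct (iso x y) as [X Y]; auto; try (rewrite Hx || rewrite Hy; lra).
  rewrite X in Hx; rewrite Y in Hy; split; apply Rmult_eq_reg_l with e; lra. }
destruct (characteristic_ray w x y NF) as (a & b & t & xs & ys & mu & Hab & Ht & Ex & Ey & Ps & Qs & H & _).
specialize (H1 x y ltac:(rewrite Hx; lra) ltac:(rewrite Hy; lra)).
specialize (H2 x y ltac:(rewrite Hx; lra) ltac:(rewrite Hy; lra)).
rewrite Rminus_0_r in H1, H2.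
assert (Ba : Rabs (a * t) <= r / 2 /\ Rabs (b * t) <= r / 2).
{ rewrite !Rabs_mult, (Rabs_pos_eq t) by lra.
  destruct (unit_vector_Rabs_le a b Hab).
  generalize (Rmult_le_compat_r t (Rabs a) 1), (Rmult_le_compat_r t (Rabs b) 1); lra. }
destruct (iso xs ys) as [-> ->]; auto.
- replace (xs - x0) with (e * h + - (a * t)) by lra.
  generalize (Rabs_triang (e * h) (- (a * t))); rewrite Rabs_Ropp; lra.
- replace (ys - y0) with (e * k + - (b * t)) by lra.
  generalize (Rabs_triang (e * k) (- (b * t))); rewrite Rabs_Ropp; lra.
(* The ray reaches [e * (h, k)] at parameter [t], hence [(h, k)] at [t / e]. *)
- destruct (H (t / e)) as [G _]; [apply Rlt_le, Rdiv_lt_0_compat; lra|].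
  assert (Eh : a * (t / e) = h) by (apply Rmult_eq_reg_l with e; [|lra];
    transitivity (a * t); [field; lra|lra]).
  assert (Ek : b * (t / e) = k) by (apply Rmult_eq_reg_l with e; [|lra];
    transitivity (b * t); [field; lra|lra]).
  rewrite Eh, Ek in G.
  set (p := P w (x0 + h) (y0 + k)) in *; set (q := Q w (x0 + h) (y0 + k)) in *.
  clearbody p q; rewrite <- Eh, <- Ek.
  transitivity ((t / e) * (a * p + b * q)); [ring|rewrite G; ring].
Qed.

(* Differentiating [h P + k Q = 0] and using the curl equation gives [(t P)' = -2 t k] and
   [(t Q)' = 2 t h] along the ray [t (h, k)]. *)
Lemma nondegenerate_rotation (h k : R) :
  P w (x0 + h) (y0 + k) = - k /\ Q w (x0 + h) (y0 + k) = h.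
Proof.
assert (D1 : forall h k, P w (x0 + h) (y0 + k) +
  h * Px w (x0 + h) (y0 + k) + k * Qx w (x0 + h) (y0 + k) = 0).
{ clear h k; intros h k.
  rewrite <- (is_derive_unique (fun _ : R => 0) h 0) by apply (is_derive_const (V := R_NormedModule)).
  symmetry; apply is_derive_unique.
  apply (is_derive_ext (fun h => h * P w (x0 + h) (y0 + k) + k * Q w (x0 + h) (y0 + k))).
  { intros; apply nondegenerate_radial. }
  evar_last.
  - apply (is_derive_plus (V := R_NormedModule) (fun h => h * P w (x0 + h) (y0 + k))).
    + apply Derive.is_derive_mult; [apply (is_derive_id (K := R_AbsRing))|].
      apply (is_derive_comp_2d (P w) (fun h => x0 + h) (fun _ => y0 + k)); [apply P_diff| |]; auto_derive; auto; reflexivity.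
    + apply is_derive_scal.
      apply (is_derive_comp_2d (Q w) (fun h => x0 + h) (fun _ => y0 + k)); [apply Q_diff| |]; auto_derive; auto; reflexivity.
  - unfold plus, one; simpl; ring. }
assert (D2 : forall h k, h * Py w (x0 + h) (y0 + k) +
  Q w (x0 + h) (y0 + k) + k * Qy w (x0 + h) (y0 + k) = 0).
{ clear h k; intros h k.
  rewrite <- (is_derive_unique (fun _ : R => 0) k 0) by apply (is_derive_const (V := R_NormedModule)).
  symmetry; apply is_derive_unique.
  apply (is_derive_ext (fun k => h * P w (x0 + h) (y0 + k) + k * Q w (x0 + h) (y0 + k))).
  { intros; apply nondegenerate_radial. }
  evar_last.
  - apply (is_derive_plus (V := R_NormedModule) (fun k => h * P w (x0 + h) (y0 + k))).
    + apply is_derive_scal.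
      apply (is_derive_comp_2d (P w) (fun _ => x0 + h) (fun k => y0 + k)); [apply P_diff| |]; auto_derive; auto; reflexivity.
    + apply Derive.is_derive_mult; [apply (is_derive_id (K := R_AbsRing))|].
      apply (is_derive_comp_2d (Q w) (fun _ => x0 + h) (fun k => y0 + k)); [apply Q_diff| |]; auto_derive; auto; reflexivity.
  - unfold plus, one; simpl; ring. }
split.
- set (f t := t * P w (x0 + t * h) (y0 + t * k) + t * t * k).
  assert (E : f 0 = f 1); [|unfold f in E; rewrite !Rmult_1_l in E; lra].
  apply eq_is_derive; [|lra].
  intros t _; unfold f; evar_last.
  + apply (is_derive_plus (V := R_NormedModule) (fun t => t * P w (x0 + t * h) (y0 + t * k))).
    * apply Derive.is_derive_mult; [apply (is_derive_id (K := R_AbsRing))|].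
      apply (is_derive_comp_2d (P w)); [apply P_diff| |]; auto_derive; auto; reflexivity.
    * auto_derive; auto; reflexivity.
  + unfold plus, one, zero; simpl.
    generalize (D1 (t * h) (t * k)), (curl_eq w (x0 + t * h) (y0 + t * k)); intros A B.
    replace (Qx w (x0 + t * h) (y0 + t * k)) with (Py w (x0 + t * h) (y0 + t * k) + 2) in A by lra.
    lra.
- set (f t := t * Q w (x0 + t * h) (y0 + t * k) - t * t * h).
  assert (E : f 0 = f 1); [|unfold f in E; rewrite !Rmult_1_l in E; lra].
  apply eq_is_derive; [|lra].
  intros t _; unfold f; evar_last.
  + apply (is_derive_minus (V := R_NormedModule) (fun t => t * Q w (x0 + t * h) (y0 + t * k))).
    * apply Derive.is_derive_mult; [apply (is_derive_id (K := R_AbsRing))|].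
      apply (is_derive_comp_2d (Q w)); [apply Q_diff| |]; auto_derive; auto; reflexivity.
    * auto_derive; auto; reflexivity.
  + unfold minus, plus, opp, one, zero; simpl.
    generalize (D2 (t * h) (t * k)), (curl_eq w (x0 + t * h) (y0 + t * k)); intros A B.
    replace (Qx w (x0 + t * h) (y0 + t * k)) with (Py w (x0 + t * h) (y0 + t * k) + 2) by lra.
    lra.
Qed.
End Nondegenerate.

(** * Characteristic lines *)

Section Parallel.
Context (w : pminimal).
Context (degenerate : forall x y, P w x y = 0 -> Q w x y = 0 ->
  Px w x y * Qy w x y - Py w x y * Qx w x y = 0).

(** By the curl equation, dF is the rotation by a right angle plus a symmetric matrix, and its
    determinant is 1 plus that of the symmetric part. If [mu = 1], the symmetric part kills
    [(a, b)], so dF has determinant 1 and is not degenerate. *)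
Lemma degenerate_ray_slope (x y a b mu : R) :
  a ^ 2 + b ^ 2 = 1 -> P w x y = 0 -> Q w x y = 0 -> mu = 1 \/ mu = 2 ->
  a * Px w x y + b * Py w x y = - mu * b -> a * Qx w x y + b * Qy w x y = mu * a -> mu = 2.
Proof.
intros Hab HP HQ [->|E] E1 E2; [exfalso|exact E].
generalize (degenerate x y HP HQ), (curl_eq w x y); intros D C.
set (px := Px w x y) in *; set (py := Py w x y) in *.
set (qx := Qx w x y) in *; set (qy := Qy w x y) in *.
replace qx with (py + 2) in * by lra.
assert (A1 : a * px = - b * (py + 1)) by lra.
assert (A2 : b * qy = - a * (py + 1)) by lra.
(* Either of [a] and [b] may be 0, so the identity is proved with both factors and then summed. *)
assert (B1 : a ^ 2 * (px * qy - (py + 1) ^ 2) = 0).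
{ transitivity (a * qy * (a * px) - a ^ 2 * (py + 1) ^ 2); [ring|].
  rewrite A1; transitivity (- a * (py + 1) * (b * qy) - a ^ 2 * (py + 1) ^ 2); [ring|].
  rewrite A2; ring. }
assert (B2 : b ^ 2 * (px * qy - (py + 1) ^ 2) = 0).
{ transitivity (b * px * (b * qy) - b ^ 2 * (py + 1) ^ 2); [ring|].
  rewrite A2; transitivity (- b * (py + 1) * (a * px) - b ^ 2 * (py + 1) ^ 2); [ring|].
  rewrite A1; ring. }
assert ((a ^ 2 + b ^ 2) * (px * qy - (py + 1) ^ 2) = 0) by lra.
rewrite Hab in H; lra.
Qed.

(** The ray through [(- d, 0)] starts at a singular point close to the origin. There [mu = 2], and
    since [Px] and [Py] are small by continuity, the direction is nearly horizontal. *)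
Lemma rays_near_opposite (e : R) :
  P w 0 0 = 0 -> Q w 0 0 = 0 -> Px w 0 0 = 0 -> Qx w 0 0 = 2 -> 0 < e ->
  exists a b x0 y0, a ^ 2 + b ^ 2 = 1 /\ a < 0 /\ Rabs b < e /\ Rabs x0 < e /\ Rabs y0 < e /\
    forall s, 0 <= s -> a * P w (x0 + a * s) (y0 + b * s) + b * Q w (x0 + a * s) (y0 + b * s) = 0 /\
       s <= - b * P w (x0 + a * s) (y0 + b * s) + a * Q w (x0 + a * s) (y0 + b * s).
Proof.
intros P0 Q0 Px0 Qx0 He.
assert (Py0 : Py w 0 0 = 0) by (generalize (curl_eq w 0 0); lra).
destruct (Px_cont w 0 0 (mkposreal e He)) as [[d1 d1p] H1].
destruct (Py_cont w 0 0 (mkposreal e He)) as [[d2 d2p] H2].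
set (r := Rmin e (Rmin d1 d2)).
assert (Hr : 0 < r /\ r <= e /\ r <= d1 /\ r <= d2).
{ unfold r; repeat split; [repeat apply Rmin_pos; lra|apply Rmin_l| |];
  (eapply Rle_trans; [apply Rmin_r|]); [apply Rmin_l|apply Rmin_r]. }
assert (r4 : 0 < r / 4) by lra.
destruct (P_cont w 0 0 (mkposreal _ r4)) as [[d3 d3p] H3].
destruct (Q_cont w 0 0 (mkposreal _ r4)) as [[d4 d4p] H4].
(* Error 1 suffices: the slope is 2, so [Q] at [(- d, 0)] lies within [d] of [- 2 * d] and is
   negative. *)
destruct (Q_diff w 0 0 (mkposreal 1 Rlt_0_1)) as [[d5 d5p] H5].
simpl in H1, H2, H3, H4, H5.
rewrite Px0 in H1; rewrite Py0 in H2; rewrite P0 in H3; rewrite Q0 in H4; rewrite Q0, Qx0 in H5.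
set (d := Rmin (r / 2) (Rmin d3 (Rmin d4 d5)) / 2).
assert (Hd : 0 < d /\ d < r / 2 /\ d < d3 /\ d < d4 /\ d < d5).
{ assert (0 < Rmin (r / 2) (Rmin d3 (Rmin d4 d5))) by (repeat apply Rmin_pos; lra).
  generalize (Rmin_l (r / 2) (Rmin d3 (Rmin d4 d5))), (Rmin_r (r / 2) (Rmin d3 (Rmin d4 d5))),
    (Rmin_l d3 (Rmin d4 d5)), (Rmin_r d3 (Rmin d4 d5)), (Rmin_l d4 d5), (Rmin_r d4 d5).
  unfold d; lra. }
assert (abs_d : Rabs (- d - 0) = d) by (rewrite Rminus_0_r, Rabs_Ropp; apply Rabs_pos_eq; lra).
assert (abs_0 : Rabs (0 - 0) = 0) by (rewrite Rminus_0_r; apply Rabs_R0).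
specialize (H3 (- d) 0); specialize (H4 (- d) 0); specialize (H5 (- d) 0).
rewrite abs_d, abs_0 in H3, H4, H5.
specialize (H3 ltac:(lra) ltac:(lra)); specialize (H4 ltac:(lra) ltac:(lra)).
specialize (H5 ltac:(lra) ltac:(lra)).
rewrite (Rmax_left d 0) in H5 by lra; apply Rabs_le_between in H5.
rewrite Rminus_0_r in H3, H4.
assert (Qneg : Q w (- d) 0 < 0) by lra.
destruct (characteristic_ray w (- d) 0) as
  (a & b & t & x0 & y0 & mu & Hab & Ht & Ex & Ey & Ps & Qs & H & Hmu & E1 & E2).
{ intros [_ Z]; lra. }
assert (mu2 := degenerate_ray_slope x0 y0 a b mu Hab Ps Qs Hmu E1 E2); rewrite mu2 in E1.
assert (Ba := unit_vector_Rabs_le a b Hab).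
assert (Bt : Rabs (a * t) < r / 2 /\ Rabs (b * t) < r / 2).
{ rewrite !Rabs_mult, (Rabs_pos_eq t) by lra.
  generalize (Rmult_le_compat_r t (Rabs a) 1), (Rmult_le_compat_r t (Rabs b) 1); lra. }
assert (Bx : Rabs x0 < r).
{ replace x0 with (- (d + a * t)) by lra; rewrite Rabs_Ropp.
  generalize (Rabs_triang d (a * t)); rewrite (Rabs_pos_eq d); lra. }
assert (By : Rabs y0 < r) by (replace y0 with (- (b * t)) by lra; rewrite Rabs_Ropp; lra).
exists a, b, x0, y0; repeat split; auto; try apply H; auto; try lra.
(* F is normal to the ray at [(- d, 0)], so [Q] there is [a] times the normal component, which is at
   least [t]; as [Q < 0], [a < 0]. *)
- destruct (H t) as [G1 G2]; [lra|]; rewrite <- Ex, <- Ey in G1, G2.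
  assert (E : Q w (- d) 0 = a * (- b * P w (- d) 0 + a * Q w (- d) 0)).
  { transitivity ((a ^ 2 + b ^ 2) * Q w (- d) 0); [rewrite Hab; ring|].
    transitivity (b * (a * P w (- d) 0 + b * Q w (- d) 0) +
      a * (- b * P w (- d) 0 + a * Q w (- d) 0)); [ring|rewrite G1; ring]. }
  apply Rnot_le_lt; intros a0.
  assert (G3 : 0 <= - b * P w (- d) 0 + a * Q w (- d) 0) by lra.
  generalize (Rmult_le_pos _ _ a0 G3); lra.
(* The relation [a * Px + b * Py = - 2 * b] at the start of the ray bounds [2 * |b|] by
   [|Px| + |Py| < 2 * e]. *)
- specialize (H1 x0 y0); specialize (H2 x0 y0); rewrite !Rminus_0_r in H1, H2.
  specialize (H1 ltac:(lra) ltac:(lra)); specialize (H2 ltac:(lra) ltac:(lra)).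
  assert (Eb : 2 * Rabs b = Rabs (a * Px w x0 y0 + b * Py w x0 y0)).
  { rewrite E1, Rabs_mult, Rabs_Ropp, (Rabs_pos_eq 2); lra. }
  generalize (Rabs_triang (a * Px w x0 y0) (b * Py w x0 y0)); rewrite !Rabs_mult.
  generalize (Rmult_le_compat_r _ _ _ (Rabs_pos (Px w x0 y0)) (proj1 Ba)),
    (Rmult_le_compat_r _ _ _ (Rabs_pos (Py w x0 y0)) (proj2 Ba)); lra.
Qed.

(* The rays through points just behind the singular point converge to the opposite ray. *)
Lemma opposite_ray (s : R) :
  P w 0 0 = 0 -> Q w 0 0 = 0 -> Px w 0 0 = 0 -> Qx w 0 0 = 2 -> 0 <= s ->
  P w (- s) 0 = 0 /\ Q w (- s) 0 <= - s.
Proof.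
intros P0 Q0 Px0 Qx0 Hs.
(* In 3, two units come from bounding the nearby values by [|p| + 1] and [|q| + 1], one from their
   distance to [p] or [q]. *)
set (p := P w (- s) 0); set (q := Q w (- s) 0); set (K := Rabs p + Rabs q + 3).
assert (K0 : 0 < K) by (unfold K; generalize (Rabs_pos p), (Rabs_pos q); lra).
assert (main : forall e, 0 < e < 1 -> Rabs p <= e * K /\ q + s <= e * K).
{ intros e He.
  destruct (P_cont w (- s) 0 (mkposreal e (proj1 He))) as [[d1 d1p] H1].
  destruct (Q_cont w (- s) 0 (mkposreal e (proj1 He))) as [[d2 d2p] H2]; simpl in H1, H2.
  set (d := Rmin e (Rmin d1 d2 / (1 + s))).
  assert (m0 : 0 < Rmin d1 d2) by now apply Rmin_pos.
  assert (Hd : 0 < d /\ d <= e /\ d * (1 + s) <= Rmin d1 d2).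
  { unfold d; repeat split; [apply Rmin_pos; [lra|apply Rdiv_lt_0_compat; lra]|apply Rmin_l|].
    apply Rle_trans with (Rmin d1 d2 / (1 + s) * (1 + s)); [|right; field; lra].
    apply Rmult_le_compat_r; [lra|apply Rmin_r]. }
  destruct (rays_near_opposite d) as (a & b & x0 & y0 & Hab & Ha & Hb & Hx & Hy & H); auto; [lra|].
  destruct (H s Hs) as [G1 G2].
  (* From [(1 + a) * (1 - a) = b ^ 2] and [a < 0], [1 + a <= b ^ 2 < d], as [|b| < d < 1]. *)
  assert (a1 : Rabs (1 + a) < d).
  { rewrite <- (pow2_abs b) in Hab.
    assert (-1 <= a) by (generalize (pow2_ge_0 (Rabs b)); nra).
    rewrite Rabs_pos_eq by lra.
    generalize (Rabs_pos b); nra. }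
  assert (Dx : Rabs (x0 + a * s - - s) < Rmin d1 d2).
  { replace (x0 + a * s - - s) with (x0 + (1 + a) * s) by ring.
    eapply Rle_lt_trans; [apply Rabs_triang|]; rewrite Rabs_mult, (Rabs_pos_eq s) by lra.
    generalize (Rmult_le_compat_r s _ _ Hs (Rlt_le _ _ a1)); lra. }
  assert (Dy : Rabs (y0 + b * s - 0) < Rmin d1 d2).
  { rewrite Rminus_0_r.
    eapply Rle_lt_trans; [apply Rabs_triang|]; rewrite Rabs_mult, (Rabs_pos_eq s) by lra.
    generalize (Rmult_le_compat_r s _ _ Hs (Rlt_le _ _ Hb)); lra. }
  assert (M1 := Rmin_l d1 d2); assert (M2 := Rmin_r d1 d2).
  specialize (H1 _ _ (Rlt_le_trans _ _ _ Dx M1) (Rlt_le_trans _ _ _ Dy M1)).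
  specialize (H2 _ _ (Rlt_le_trans _ _ _ Dx M2) (Rlt_le_trans _ _ _ Dy M2)).
  fold p in H1; fold q in H2.
  set (p' := P w _ _) in H1, G1, G2; set (q' := Q w _ _) in H2, G1, G2.
  assert (Bp : Rabs p' <= Rabs p + 1).
  { replace p' with (p + (p' - p)) by ring; generalize (Rabs_triang p (p' - p)); lra. }
  assert (Bq : Rabs q' <= Rabs q + 1).
  { replace q' with (q + (q' - q)) by ring; generalize (Rabs_triang q (q' - q)); lra. }
  assert (prod : forall u v B, Rabs u < d -> Rabs v <= B -> Rabs (u * v) <= e * B).
  { intros u v B Hu Hv; rewrite Rabs_mult; apply Rmult_le_compat; auto using Rabs_pos; lra. }
  assert (X1 := prod _ _ _ a1 Bp); assert (X2 := prod _ _ _ Hb Bq).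
  assert (X3 := prod _ _ _ a1 Bq); assert (X4 := prod _ _ _ Hb Bp).
  apply Rabs_lt_between in H1; apply Rabs_lt_between in H2.
  apply Rabs_le_between in X1; apply Rabs_le_between in X2.
  apply Rabs_le_between in X3; apply Rabs_le_between in X4.
  unfold K; split; [apply Rabs_le|]; lra. }
assert (lim : forall x, (forall e, 0 < e < 1 -> x <= e * K) -> x <= 0).
{ intros x Hx; apply le_epsilon; intros e He; rewrite Rplus_0_l.
  assert (0 < Rmin (e / K) (1 / 2)) by (apply Rmin_pos; [apply Rdiv_lt_0_compat; lra|lra]).
  apply Rle_trans with (Rmin (e / K) (1 / 2) * K).
  - apply Hx; generalize (Rmin_r (e / K) (1 / 2)); lra.
  - apply Rle_trans with (e / K * K); [apply Rmult_le_compat_r; [lra|apply Rmin_l]|].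
    right; field; lra. }
assert (Lp : Rabs p <= 0) by (apply lim; intros e He; apply (main e He)).
assert (Lq : q + s <= 0) by (apply lim; intros e He; apply (main e He)).
split; [|lra].
destruct (Req_dec p 0) as [|N]; auto; generalize (Rabs_pos_lt p N); lra.
Qed.
End Parallel.

(** The first two clauses say that dF at [(x0, y0)] sends [(a, b)] to twice its normal [(- b, a)].
    The bound by [|s|] leaves [s = 0] as the only possible zero of F on the line. *)
Definition characteristic_line (w : pminimal) (a b x0 y0 : R) : Prop :=
  a * Px w x0 y0 + b * Py w x0 y0 = - 2 * b /\ a * Qx w x0 y0 + b * Qy w x0 y0 = 2 * a /\
  forall s, a * P w (x0 + a * s) (y0 + b * s) + b * Q w (x0 + a * s) (y0 + b * s) = 0 /\
    Rabs s <= Rabs (- b * P w (x0 + a * s) (y0 + b * s) + a * Q w (x0 + a * s) (y0 + b * s)).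

(** The half [s >= 0] is the characteristic ray; the other half is [opposite_ray] in the frame where
    that ray is the positive x-axis. *)
Lemma characteristic_line_through (w : pminimal) (x y : R) :
  (forall x y, P w x y = 0 -> Q w x y = 0 ->
    Px w x y * Qy w x y - Py w x y * Qx w x y = 0) ->
  ~ (P w x y = 0 /\ Q w x y = 0) ->
  exists a b t x0 y0, a ^ 2 + b ^ 2 = 1 /\ x = x0 + a * t /\ y = y0 + b * t /\
    characteristic_line w a b x0 y0.
Proof.
intros deg N.
destruct (characteristic_ray w x y N) as
  (a & b & t & x0 & y0 & mu & Hab & Ht & Ex & Ey & P0 & Q0 & H & Hmu & E1 & E2).
assert (mu2 := degenerate_ray_slope w deg x0 y0 a b mu Hab P0 Q0 Hmu E1 E2); subst mu.
exists a, b, t, x0, y0; do 3 (split; auto); do 2 (split; [lra|]).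
- intros s; destruct (Rle_dec 0 s) as [Hs|Hs].
  { destruct (H s Hs) as [G1 G2]; split; auto.
    rewrite (Rabs_pos_eq s) by auto; eapply Rle_trans; [exact G2|apply Rle_abs]. }
  assert (C1 : x0 + a * 0 - b * 0 = x0) by ring.
  assert (C2 : y0 + b * 0 + a * 0 = y0) by ring.
  assert (D1 : x0 + a * - - s - b * 0 = x0 + a * s) by ring.
  assert (D2 : y0 + b * - - s + a * 0 = y0 + b * s) by ring.
  generalize (opposite_ray (motion w x0 y0 a b Hab)); cbn [P Q Px Py Qx Qy motion].
  intros G; destruct (G) with (s := - s) as [G1 G2]; clear G; rewrite ?C1, ?C2, ?E1, ?E2.
  (* Degeneracy passes to the moved field: its zeros correspond, and the determinant of dF is
     invariant. *)
  + intros u v Hp Hq.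
    set (X := x0 + a * u - b * v) in *; set (Y := y0 + b * u + a * v) in *.
    assert (Z1 : P w X Y = 0).
    { transitivity ((a ^ 2 + b ^ 2) * P w X Y); [rewrite Hab; ring|].
      transitivity (a * (a * P w X Y + b * Q w X Y) - b * (- b * P w X Y + a * Q w X Y)); [ring|].
      rewrite Hp, Hq; ring. }
    assert (Z2 : Q w X Y = 0).
    { transitivity ((a ^ 2 + b ^ 2) * Q w X Y); [rewrite Hab; ring|].
      transitivity (b * (a * P w X Y + b * Q w X Y) + a * (- b * P w X Y + a * Q w X Y)); [ring|].
      rewrite Hp, Hq; ring. }
    transitivity ((a ^ 2 + b ^ 2) ^ 2 * (Px w X Y * Qy w X Y - Py w X Y * Qx w X Y)); [ring|].
    rewrite deg; auto; ring.
  + rewrite P0, Q0; ring.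
  + rewrite P0, Q0; ring.
  + ring.
  + transitivity (2 * (a ^ 2 + b ^ 2)); [ring|rewrite Hab; ring].
  + lra.
  + rewrite D1, D2 in G1, G2; split; auto.
    rewrite (Rabs_left s) by lra; rewrite Rabs_left1; lra.
Qed.

Lemma characteristic_lines_parallel (w : pminimal) (a1 b1 x1 y1 a2 b2 x2 y2 : R) :
  characteristic_line w a1 b1 x1 y1 -> characteristic_line w a2 b2 x2 y2 ->
  a1 * b2 - a2 * b1 = 0.
Proof.
intros (U1 & V1 & L1) (U2 & V2 & L2).
destruct (Req_dec (a1 * b2 - a2 * b1) 0) as [|N]; auto; exfalso.
set (k := a1 * b2 - a2 * b1) in N.
(* The parameters of the intersection point on the two lines, by Cramer's rule. *)
set (s1 := ((x2 - x1) * b2 - (y2 - y1) * a2) / k).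
set (s2 := ((x2 - x1) * b1 - (y2 - y1) * a1) / k).
assert (Ex : x1 + a1 * s1 = x2 + a2 * s2) by (unfold s1, s2, k; field; exact N).
assert (Ey : y1 + b1 * s1 = y2 + b2 * s2) by (unfold s1, s2, k; field; exact N).
destruct (L1 s1) as [G1 M1]; destruct (L2 s2) as [G2 M2].
rewrite <- Ex, <- Ey in G2, M2.
set (p := P w _ _) in G1, M1, G2, M2; set (q := Q w _ _) in G1, M1, G2, M2.
assert (solve : forall u v A B, a1 * u + b1 * v = A -> a2 * u + b2 * v = B ->
  u = (b2 * A - b1 * B) / k /\ v = (a1 * B - a2 * A) / k).
{ intros u v A B <- <-; split; unfold k; field; exact N. }
(* F is orthogonal to two independent directions, hence zero; the bounds then force both parameters
   to be 0. *)
destruct (solve p q 0 0 G1 G2) as [Ep Eq].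
assert (p0 : p = 0) by (rewrite Ep; field; exact N).
assert (q0 : q = 0) by (rewrite Eq; field; exact N).
rewrite p0, q0 in M1, M2.
assert (z : forall s a b, Rabs s <= Rabs (- b * 0 + a * 0) -> s = 0).
{ intros s a b Hz; replace (- b * 0 + a * 0) with 0 in Hz by ring; rewrite Rabs_R0 in Hz.
  destruct (Req_dec s 0) as [|Ns]; auto; generalize (Rabs_pos_lt s Ns); lra. }
apply z in M1; apply z in M2.
rewrite M1, M2, !Rmult_0_r, !Rplus_0_r in Ex, Ey; subst x2 y2.
destruct (solve _ _ _ _ U1 U2) as [_ Epy]; destruct (solve _ _ _ _ V1 V2) as [Eqx _].
generalize (curl_eq w x1 y1); rewrite Epy, Eqx.
replace ((b2 * (2 * a1) - b1 * (2 * a2)) / k) with 2 by (unfold k; field; exact N).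
replace ((a1 * (-2 * b2) - a2 * (-2 * b1)) / k) with (-2) by (unfold k; field; exact N).
lra.
Qed.

Lemma pminimal_rotation_or_parallel (w : pminimal) :
  (exists x0 y0, forall x y, P w x y = - (y - y0) /\ Q w x y = x - x0) \/
  (exists a b, a ^ 2 + b ^ 2 = 1 /\ forall x y, a * P w x y + b * Q w x y = 0).
Proof.
destruct (classic (exists x y, P w x y = 0 /\ Q w x y = 0 /\
  Px w x y * Qy w x y - Py w x y * Qx w x y <> 0)) as [(x0 & y0 & P0 & Q0 & det)|N].
{ left; exists x0, y0; intros x y.
  generalize (nondegenerate_rotation w x0 y0 P0 Q0 det (x - x0) (y - y0)).
  now replace (x0 + (x - x0)) with x by ring; replace (y0 + (y - y0)) with y by ring. }
right.
assert (deg : forall x y, P w x y = 0 -> Q w x y = 0 ->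
    Px w x y * Qy w x y - Py w x y * Qx w x y = 0).
{ intros x y HP HQ; apply NNPP; intros H; apply N; exists x, y; auto. }
destruct (classic (exists x y, ~ (P w x y = 0 /\ Q w x y = 0))) as [(x1 & y1 & R1)|Z].
- destruct (characteristic_line_through w x1 y1 deg R1) as (a & b & t & x0 & y0 & Hab & _ & _ & L).
  exists a, b; split; auto; intros x y.
  destruct (classic (P w x y = 0 /\ Q w x y = 0)) as [[-> ->]|R2]; [ring|].
  destruct (characteristic_line_through w x y deg R2) as
    (a' & b' & t' & x' & y' & Hab' & Ex & Ey & L').
  assert (Par := characteristic_lines_parallel _ _ _ _ _ _ _ _ _ L L').
  destruct L' as (_ & _ & L'); destruct (L' t') as [G _]; rewrite <- Ex, <- Ey in G.
  set (p := P w x y) in *; set (q := Q w x y) in *.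
  transitivity ((a' ^ 2 + b' ^ 2) * (a * p + b * q)); [rewrite Hab'; ring|].
  (* [(a, b)] is expanded in [(a', b')] and its normal; the normal coefficient vanishes by
     parallelism. *)
  transitivity ((a * a' + b * b') * (a' * p + b' * q) + (a * b' - a' * b) * (b' * p - a' * q)); [ring|].
  rewrite G, Par; ring.
(* F cannot vanish identically, since its curl is 2. *)
- exfalso.
  assert (PZ : forall x y, P w x y = 0) by (intros x y; apply NNPP; intros H; apply Z; exists x, y; tauto).
  assert (QZ : forall x y, Q w x y = 0) by (intros x y; apply NNPP; intros H; apply Z; exists x, y; tauto).
  destruct (differentiable_pt_lim_unique _ _ _ _ _ (P_diff w 0 0)) as [_ Ey].
  destruct (differentiable_pt_lim_unique _ _ _ _ _ (Q_diff w 0 0)) as [Ex _].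
  rewrite (Derive_ext _ (fun _ => 0)), Derive_const in Ey by (intros; apply PZ).
  rewrite (Derive_ext _ (fun _ => 0)), Derive_const in Ex by (intros; apply QZ).
  generalize (curl_eq w 0 0); lra.
Qed.

(** * Graphs *)

Lemma C1_differentiable (f : R -> R -> R) (x y : R) :
  has_partials f -> cont2 (dx f) -> differentiable_pt_lim f x y (dx f x y) (dy f x y).
Proof.
intros Hp Hc; apply filterdiff_differentiable_pt_lim.
apply (is_derive_filterdiff f x y (dx f) (dy f x y)).
- apply filter_forall; intros [u v].
  exact (Derive_correct (fun z => f z v) u (proj1 (Hp u v))).
- exact (Derive_correct (fun z => f x z) y (proj2 (Hp x y))).
- exact (Hc x y).
Qed.

Lemma cont2_continuity_2d (f : R -> R -> R) (x y : R) : cont2 f -> continuity_2d_pt f x y.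
Proof. intros H; apply continuity_2d_pt_filterlim, H. Qed.

Lemma C2_mixed_partials (u : R -> R -> R) (x y : R) :
  C2_plane u -> dx (dy u) x y = dy (dx u) x y.
Proof.
intros (Hu & Hux & Huy & _ & _ & _ & _ & Cxy & Cyx & _).
apply Schwarz; try now apply cont2_continuity_2d.
exists (mkposreal 1 Rlt_0_1); intros s t _ _.
exact (conj (proj1 (Hu s t)) (conj (proj2 (Hu s t)) (conj (proj1 (Huy s t)) (proj2 (Hux s t))))).
Qed.

Lemma pminimal_of_graph (u : R -> R -> R) :
  C2_plane u ->
  (forall x y,
     (dy u x y + x) ^ 2 * dx (dx u) x y
     - 2 * (dy u x y + x) * (dx u x y - y) * dy (dx u) x y
     + (dx u x y - y) ^ 2 * dy (dy u) x y = 0) ->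
  exists w : pminimal, forall x y, P w x y = dx u x y - y /\ Q w x y = dy u x y + x.
Proof.
intros Hu Hmin; assert (mix := fun x y => C2_mixed_partials u x y Hu).
destruct Hu as (Hu & Hux & Huy & _ & _ & _ & Cxx & Cxy & Cyx & Cyy).
unshelve refine (ex_intro _ {|
  P := fun x y => dx u x y - y; Q := fun x y => dy u x y + x;
  Px := dx (dx u); Py := fun x y => dy (dx u) x y - 1;
  Qx := fun x y => dx (dy u) x y + 1; Qy := dy (dy u) |} _); try intros x y.
- apply differentiable_pt_lim_ext with (fun x y => 1 * dx u x y + (-1) * (0 + 0 * x + 1 * y)).
  { exists (mkposreal 1 Rlt_0_1); intros; ring. }
  replace (dx (dx u) x y) with (1 * dx (dx u) x y + (-1) * 0) by ring.
  replace (dy (dx u) x y - 1) with (1 * dy (dx u) x y + (-1) * 1) by ring.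
  apply (differentiable_lincomb (dx u)); [now apply C1_differentiable|apply differentiable_affine].
- apply differentiable_pt_lim_ext with (fun x y => 1 * dy u x y + 1 * (0 + 1 * x + 0 * y)).
  { exists (mkposreal 1 Rlt_0_1); intros; ring. }
  replace (dx (dy u) x y + 1) with (1 * dx (dy u) x y + 1 * 1) by ring.
  replace (dy (dy u) x y) with (1 * dy (dy u) x y + 1 * 0) by ring.
  apply (differentiable_lincomb (dy u)); [now apply C1_differentiable|apply differentiable_affine].
- now apply cont2_continuity_2d.
- apply (continuity_2d_pt_minus (dy (dx u))); [now apply cont2_continuity_2d|apply continuity_2d_pt_const].
- apply (continuity_2d_pt_plus (dx (dy u))); [now apply cont2_continuity_2d|apply continuity_2d_pt_const].
- now apply cont2_continuity_2d.
- rewrite mix; ring.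
- rewrite mix, <- (Hmin x y); ring.
- split; reflexivity.
Qed.

Lemma affine_of_const_gradient (u : R -> R -> R) (a b : R) :
  (forall x y, differentiable_pt_lim u x y a b) ->
  forall x y, u x y = a * x + b * y + u 0 0.
Proof.
intros Du x y.
set (f t := u (t * x) (t * y) - t * (a * x + b * y)).
assert (E : f 0 = f 1); [|unfold f in E; rewrite !Rmult_1_l, !Rmult_0_l in E; lra].
apply eq_is_derive; [|lra].
intros t _; unfold f; evar_last.
- apply (is_derive_minus (V := R_NormedModule) (fun t => u (t * x) (t * y))).
  + apply (is_derive_comp_2d u (fun t => t * x) (fun t => t * y)); [apply Du| |]; auto_derive; auto; reflexivity.
  + auto_derive; auto; reflexivity.
- unfold minus, plus, opp, zero; simpl; ring.
Qed.

Lemma C2_plane_line (u : R -> R -> R) (a b : R) :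
  C2_plane u -> C2_line (fun t => u (a * t) (b * t)).
Proof.
intros (Hu & Hux & Huy & _ & Cx & _ & Cxx & Cxy & Cyx & Cyy) t.
assert (D : forall f t, has_partials f -> cont2 (dx f) -> is_derive (fun t => f (a * t) (b * t)) t
    (dx f (a * t) (b * t) * a + dy f (a * t) (b * t) * b)).
{ intros f s Hf Hc; apply (is_derive_comp_2d f (fun t => a * t) (fun t => b * t));
    [now apply C1_differentiable| |]; auto_derive; auto; ring. }
set (g := fun t => u (a * t) (b * t)).
assert (D1 : forall t, is_derive g t (dx u (a * t) (b * t) * a + dy u (a * t) (b * t) * b)).
{ intros s; now apply D. }
assert (E1 : forall t, Derive g t = dx u (a * t) (b * t) * a + dy u (a * t) (b * t) * b).
{ intros s; apply is_derive_unique, D1. }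
(* [h] is the second directional derivative of [u] along the line. *)
set (h t := (dx (dx u) (a * t) (b * t) * a + dy (dx u) (a * t) (b * t) * b) * a
          + (dx (dy u) (a * t) (b * t) * a + dy (dy u) (a * t) (b * t) * b) * b).
assert (D2 : forall t, is_derive (Derive g) t (h t)).
{ intros s; eapply is_derive_ext; [intros r; symmetry; apply E1|].
  apply (is_derive_plus (V := R_NormedModule) (fun t => dx u (a * t) (b * t) * a)
    (fun t => dy u (a * t) (b * t) * b)); (evar_last;
    [apply Derive.is_derive_mult; [apply D; auto|apply (is_derive_const (V := R_NormedModule))]
    |unfold zero; simpl; ring]). }
assert (C : forall f s l, is_derive f s l -> continuity_pt f s).
{ intros f s l H; apply continuity_pt_filterlim, (ex_derive_continuous f); now exists l. }
split; [eexists; exact (D1 t)|split; [eexists; exact (D2 t)|]].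
split; [exact (C g t _ (D1 t))|split; [exact (C (Derive g) t _ (D2 t))|]].
apply continuity_pt_ext with h.
{ intros s; symmetry; apply is_derive_unique, D2. }
apply continuity_pt_filterlim; change (continuous h t); unfold h.
prove_continuous; now apply cont2_continuity_2d.
Qed.

(* On the lines with direction [(a, b)] the function [u] differs by a constant from the quadratic
   polynomial, which vanishes along [(-b, a)]; hence [g t = u (- b t) (a t)]. *)
Lemma ruled_of_parallel (u : R -> R -> R) (a b : R) :
  (forall x y, differentiable_pt_lim u x y (dx u x y) (dy u x y)) ->
  a ^ 2 + b ^ 2 = 1 ->
  (forall x y, a * (dx u x y - y) + b * (dy u x y + x) = 0) ->
  forall x y,
    u x y = - a * b * x ^ 2 + (a ^ 2 - b ^ 2) * x * y + a * b * y ^ 2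
            + u (- b * (- b * x + a * y)) (a * (- b * x + a * y)).
Proof.
intros Du Hab H x y.
set (s := a * x + b * y); set (t := - b * x + a * y).
(* Along the line with fixed [t] the derivative of [u] is [a * y - b * x = t], so [f] is constant;
   the product [s * t] is the quadratic polynomial. *)
set (f r := u (- b * t + a * r) (a * t + b * r) - t * r).
assert (E : f 0 = f s).
{ assert (f' : forall r, is_derive f r 0).
  { intros r; unfold f; evar_last.
    - apply (is_derive_minus (V := R_NormedModule) (fun r => u (- b * t + a * r) (a * t + b * r))).
      + apply (is_derive_comp_2d u (fun r => - b * t + a * r) (fun r => a * t + b * r)); [apply Du| |];
          auto_derive; auto; reflexivity.
      + auto_derive; auto; reflexivity.
    - unfold minus, plus, opp; simpl.
      generalize (H (- b * t + a * r) (a * t + b * r)).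
      set (ux := dx u _ _); set (uy := dy u _ _); intros G.
      enough (a * (a * t + b * r) - b * (- b * t + a * r) = t) by lra.
      transitivity ((a ^ 2 + b ^ 2) * t); [ring|rewrite Hab; ring]. }
  destruct (Rtotal_order 0 s) as [L|[L|L]].
  - now apply (eq_is_derive f 0 s).
  - now rewrite <- L.
  - symmetry; now apply (eq_is_derive f s 0). }
unfold f in E; rewrite !Rmult_0_r, !Rplus_0_r, Rminus_0_r in E.
replace (- b * t + a * s) with x in E.
- replace (a * t + b * s) with y in E.
  + rewrite E; unfold s, t; ring.
  + transitivity ((a ^ 2 + b ^ 2) * y); [rewrite Hab; ring|unfold s, t; ring].
- transitivity ((a ^ 2 + b ^ 2) * x); [rewrite Hab; ring|unfold s, t; ring].
Qed.

Theorem theoremA (u : R -> R -> R) :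
  C2_plane u ->
  (forall x y,
     (dy u x y + x) ^ 2 * dx (dx u) x y
     - 2 * (dy u x y + x) * (dx u x y - y) * dy (dx u) x y
     + (dx u x y - y) ^ 2 * dy (dy u) x y = 0) ->
  (exists a b c : R, forall x y, u x y = a * x + b * y + c) \/
  (exists (a b : R) (g : R -> R),
     a ^ 2 + b ^ 2 = 1 /\ C2_line g /\
     forall x y,
       u x y = - a * b * x ^ 2 + (a ^ 2 - b ^ 2) * x * y + a * b * y ^ 2
               + g (- b * x + a * y)).
Proof.
intros Hu Hmin.
assert (Du : forall x y, differentiable_pt_lim u x y (dx u x y) (dy u x y)).
{ destruct Hu as (Hp & _ & _ & _ & Cx & _); intros; now apply C1_differentiable. }
destruct (pminimal_of_graph u Hu Hmin) as [w Hw].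
destruct (pminimal_rotation_or_parallel w) as [(x0 & y0 & H)|(a & b & Hab & H)].
(* When F is the rotation about [(x0, y0)], the terms in [x] and [y] cancel and the gradient of [u]
   is [(y0, - x0)]. *)
- left; exists y0, (- x0), (u 0 0); apply affine_of_const_gradient; intros x y.
  destruct (Hw x y) as [E1 E2]; destruct (H x y) as [F1 F2].
  replace y0 with (dx u x y) by lra; replace (- x0) with (dy u x y) by lra; auto.
- right; exists a, b, (fun t => u (- b * t) (a * t)); split; [exact Hab|split].
  + now apply C2_plane_line.
  + apply ruled_of_parallel; auto; intros x y.
    destruct (Hw x y) as [<- <-]; apply H.
Qed.
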